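(* Let $n\ge2$ and let $\nu\ge2$ be even. Let $(z_0,p_0)$ be an ambiently transverse contact of order $\nu$ of the family $(X_p,h_p)$, $p\in P\subset\mathbb R^m$, and let $\mathcal G_\nu\subset P$ be the selected projected contact stratum near $p_0$ (see context). Suppose that, for $p\in\mathcal G_\nu$, a smooth choice of local sections and a seam-centred coordinate $q$ produces a smooth reference displacement $S(q,p)$. Define $$A_\nu:\mathcal G_\nu\to\mathbb R^n,\qquad A_\nu(p)=\left(S(0,p),\frac{\partial_qS(0,p)}{1!},\dots,\frac{\partial_q^{n-1}S(0,p)}{(n-1)!}\right).$$ Assume $$A_\nu(p_0)=0,\qquad c_n:=\frac{\partial_q^nS(0,p_0)}{n!}\ne0,\qquad\operatorname{rank}d(A_\nu)_{p_0}=n,$$ where the differential is taken on $T_{p_0}\mathcal G_\nu$. Then the order-$n$ neutral grazing locus $$\mathcal N_{n,\nu}=\{p\in\mathcal G_\nu:A_\nu(p)=0\}$$ is a smooth embedded submanifold germ and $$\operatorname{codim}_P\mathcal N_{n,\nu}=n+\nu-2.$$ In particular, the hypotheses force $m\ge n+\nu-2$.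
   Context: $M$ is a smooth surface, $P\subset\mathbb R^m$ is open, and $(X_p,h_p)$ is a smooth parameter family of a vector field and a switching function on $M$. Write $H_k(z,p)=L_{X_p}^kh_p(z)$ and $\mathcal J_\nu(z,p)=(H_0,\dots,H_{\nu-1})(z,p)\in\mathbb R^\nu$. $(z_0,p_0)$ is an ambiently transverse contact of order $\nu$ if $\mathcal J_\nu(z_0,p_0)=0$, $H_\nu(z_0,p_0)\ne0$, $\operatorname{rank}D_{(z,p)}\mathcal J_\nu(z_0,p_0)=\nu$, $X_{p_0}(z_0)\ne0$ and $d_zh_{p_0}(z_0)\ne0$. In that case, in small neighbourhoods of $(z_0,p_0)$ and $p_0$, the incidence set $\mathcal I_\nu=\{\mathcal J_\nu=0\}$ is a smooth submanifold of codimension $\nu$ in $M\times P$, and the parameter projection embeds it onto a smooth embedded submanifold germ $\mathcal G_\nu=\pi_P(\mathcal I_\nu)$ of $P$, the selected projected contact stratum. The reference displacement is $S(q,p)=P^-_p(q)-q$, where $P_p^-$ is the return map of the reference field ($X_p$, playing the role of $X_p^-$) in a section coordinate $q$ for which $q=0$ is the reference orbit through the contact point $z(p)$; only that $S$ is a smooth function of $q$ near $0$ and $p\in\mathcal G_\nu$ near $p_0$ is used in the statement. *)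

(* Defs.v *)
From HB Require Import structures.
From mathcomp Require Import all_boot all_order all_algebra.
From mathcomp Require Import all_classical all_reals all_analysis.
Import Order.TTheory GRing.Theory Num.Theory.
Import numFieldNormedType.Exports.

Set Implicit Arguments.
Unset Strict Implicit.
Unset Printing Implicit Defensive.

Local Open Scope classical_set_scope.
Local Open Scope ring_scope.

(* Intended for A open and V finite-dimensional, where (Fréchet)
   differentiability together with C^k directional derivatives is the usual
   C^(k+1). *)
Fixpoint Ck_on (R : realType) (V W : normedModType R) (k : nat)
    (A : set V) (f : V -> W) : Prop :=
  if k is k'.+1 then
    (forall x, A x -> differentiable f x) /\ (forall v, Ck_on k' A ('D_v f))
  else forall x, A x -> {for x, continuous f}.

Definition smooth_on (R : realType) (V W : normedModType R)
    (A : set V) (f : V -> W) : Prop := forall k, Ck_on k A f.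

(* Smoothness near a of a function that matters only on the subset A:
   local smooth extendability to the ambient space. *)
Definition smooth_near_in (R : realType) (V W : normedModType R)
    (A : set V) (a : V) (f : V -> W) : Prop :=
  exists (O : set V) (F : V -> W),
    [/\ open_nbhs a O, smooth_on O F & forall x, O x -> A x -> f x = F x].

(* A smooth surface given by an atlas; [chart_coord i] and [chart_param i] are
   mutually inverse on the chart domain [chart_dom i] and its image (their
   values elsewhere are irrelevant), and [chart_at z] is some chart around z. *)
Record surface (R : realType) := Surface {
  carrier :> topologicalType ;
  chart : Type ;
  chart_dom : chart -> set carrier ;
  chart_coord : chart -> carrier -> 'rV[R]_2 ;
  chart_param : chart -> 'rV[R]_2 -> carrier ;
  chart_at : carrier -> chart ;
  surface_hausdorff : hausdorff_space carrier ;
  surface_second_countable : @second_countable carrier ;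
  chart_dom_open : forall i, open (chart_dom i) ;
  chart_image_open : forall i, open (chart_coord i @` chart_dom i) ;
  chart_coordK : forall i z, chart_dom i z ->
    chart_param i (chart_coord i z) = z ;
  chart_coord_continuous : forall i z, chart_dom i z ->
    {for z, continuous (chart_coord i)} ;
  chart_param_continuous : forall i x, (chart_coord i @` chart_dom i) x ->
    {for x, continuous (chart_param i)} ;
  transition_smooth : forall i j,
    smooth_on (chart_coord i @` (chart_dom i `&` chart_dom j))
      (chart_coord j \o chart_param i) ;
  dom_chart_at : forall z, chart_dom (chart_at z) z
}.

Section contacts.
Context {R : realType} {M : surface R} {m : nat}.

Implicit Types (P G : set 'rV[R]_m) (h : M -> 'rV[R]_m -> R).

Definition smooth_function_family P h : Prop :=
  forall i : chart M,
    smooth_on ((chart_coord i @` chart_dom i) `*` P)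
      (fun a : 'rV[R]_2 * 'rV[R]_m => h (chart_param i a.1) a.2).

(* A family of tangent vector fields is given by its components: [X i z p] is
   the coordinate vector of X_p(z) in the chart i, for z in [chart_dom i]. *)
Implicit Type X : chart M -> M -> 'rV[R]_m -> 'rV[R]_2.

Definition smooth_vector_field_family P X : Prop :=
  (forall (i j : chart M) (z : M) (p : 'rV[R]_m),
    chart_dom i z -> chart_dom j z -> P p ->
    X j z p = 'd (chart_coord j \o chart_param i : 'rV[R]_2 -> 'rV[R]_2)
                 (chart_coord i z) (X i z p)) /\
  (forall i : chart M,
    smooth_on ((chart_coord i @` chart_dom i) `*` P)
      (fun a : 'rV[R]_2 * 'rV[R]_m => X i (chart_param i a.1) a.2)).

(* L_{X_p} f_p at z, computed in a chart around z (the value is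
   chart-independent by the transformation law above). *)
Definition lie_derivative X (f : M -> 'rV[R]_m -> R) : M -> 'rV[R]_m -> R :=
  fun z p => let i := chart_at z in
    'D_(X i z p) (fun x : 'rV[R]_2 => f (chart_param i x) p) (chart_coord i z).

Definition iter_lie X h (k : nat) : M -> 'rV[R]_m -> R :=
  iter k (lie_derivative X) h.

Definition jet X h (nu : nat) (z : M) (p : 'rV[R]_m) : 'rV[R]_nu :=
  \row_(k < nu) iter_lie X h k z p.

Definition transverse_contact P X h (nu : nat) (z0 : M) (p0 : 'rV[R]_m) :
    Prop :=
  let i := chart_at z0 in
  P p0 /\
  [/\ jet X h nu z0 p0 = 0,
      iter_lie X h nu z0 p0 != 0,
      (\dim (limg (linfun
         ('d (fun a : 'rV[R]_2 * 'rV[R]_m => jet X h nu (chart_param i a.1) a.2)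
             (chart_coord i z0, p0)))) = nu)%N,
      X i z0 p0 != 0 &
      exists v, 'd (fun x : 'rV[R]_2 => h (chart_param i x) p0)
                   (chart_coord i z0) v != 0].

Definition incidence_set P X h (nu : nat) : set (M * 'rV[R]_m) :=
  [set a | P a.2 /\ jet X h nu a.1 a.2 = 0].

(* The projected contact stratum selected by the neighbourhood O of the
   contact; its germ at p0 does not depend on O once O is small. *)
Definition projected_stratum P X h (nu : nat) (O : set (M * 'rV[R]_m)) :
    set 'rV[R]_m :=
  snd @` (incidence_set P X h nu `&` O).

(* Slice-chart definition of a smooth embedded submanifold of codimension k of
   the open set P. *)
Definition embedded_submanifold (k : nat) P (N : set 'rV[R]_m) : Prop :=
  (k <= m)%N /\ N `<=` P /\
  forall p, N p ->
    exists (O : set 'rV[R]_m) (Phi Psi : 'rV[R]_m -> 'rV[R]_m),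
      [/\ open_nbhs p O /\ O `<=` P,
          smooth_on O Phi,
          open (Phi @` O) /\ smooth_on (Phi @` O) Psi,
          forall x, O x -> Psi (Phi x) = x &
          forall x, O x ->
            (N x <-> forall i : 'I_m, (i < k)%N -> Phi x ord0 i = 0)].

Definition embedded_submanifold_germ (k : nat) P (N : set 'rV[R]_m)
    (p0 : 'rV[R]_m) : Prop :=
  exists2 W : set 'rV[R]_m, open_nbhs p0 W & embedded_submanifold k P (N `&` W).

Definition smooth_curve_in G (p0 : 'rV[R]_m) (g : R -> 'rV[R]_m) : Prop :=
  g 0 = p0 /\
  exists O : set R,
    [/\ open_nbhs 0 O, smooth_on O g & forall t, O t -> G (g t)].

Definition tangent_vector G (p0 v : 'rV[R]_m) : Prop :=
  exists2 g, smooth_curve_in G p0 g & derive1 g 0 = v.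

(* rank of d(A)_{p0} : T_{p0}G -> R^n; T is the tangent space, and L (relevant
   only on T) the differential. *)
Definition differential_rank G (n : nat) (A : 'rV[R]_m -> 'rV[R]_n)
    (p0 : 'rV[R]_m) (r : nat) : Prop :=
  exists (T : {vspace 'rV[R]_m}) (L : 'Hom('rV[R]_m, 'rV[R]_n)),
    [/\ forall v, v \in T <-> tangent_vector G p0 v,
        forall g, smooth_curve_in G p0 g ->
          derive1 (A \o g) 0 = L (derive1 g 0) &
        (\dim (L @: T) = r)%N].

Definition taylor_coef (S : R -> 'rV[R]_m -> R) (k : nat) (p : 'rV[R]_m) : R :=
  derive1n k (fun q : R => S q p) 0 / k`!%:R.

Definition taylor_map (n : nat) (S : R -> 'rV[R]_m -> R) (p : 'rV[R]_m) :
    'rV[R]_n :=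
  \row_(k < n) taylor_coef S k p.

Definition neutral_grazing_locus (n : nat) G (S : R -> 'rV[R]_m -> R) :
    set 'rV[R]_m :=
  [set p | G p /\ taylor_map n S p = 0].

End contacts.

(* Main.v *)
From HB Require Import structures.
Require Import Defs.
From mathcomp Require Import all_boot all_order all_algebra.
From mathcomp Require Import all_classical all_reals all_analysis.
From mathcomp Require Import ring lra zify.
Import Order.TTheory GRing.Theory Num.Theory.
Import numFieldNormedType.Exports.

(** Why the theorem is true.  Work in the chart around the contact point and
    write F_k(x, p) for L_X^k h in that chart, so that the incidence set is
    {F_0 = ... = F_(nu-1) = 0} and the partial derivative of F_k along X is
    F_(k+1).  At the contact this gives D_X F_0 = F_1 = 0 and
    D_X F_(nu-1) = F_nu <> 0, while D_x F_0 <> 0.  Hence the two covectors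
    D_x F_0 and D_x F_(nu-1) on the surface are independent, and the implicit
    function theorem solves F_0 = F_(nu-1) = 0 by x = zeta(p).  The projected
    stratum is then the germ {g_1 = ... = g_(nu-2) = 0} with
    g_k(p) = F_k(zeta(p), p).  Since the full jet is a submersion in (x, p),
    eliminating x leaves g a submersion in p: two of the nu equations are spent
    on the two coordinates of the surface ([stratum_equations]).

    On the stratum the Taylor coefficients of S are the restrictions of smooth
    functions c_0, ..., c_(n-1) of p, read off an ambient extension of S.
    Tangent vectors of the stratum are killed by dg, and the rank hypothesis
    says that dc maps them onto R^n; together with the surjectivity of dg this
    makes (c, g) a submersion of rank n + nu - 2 at p0.  The neutral grazing
    locus is its zero set, and a submersion is a linear projection in suitable
    coordinates ([submersion_slice]), which gives both the slice charts and the
    inequality n + nu - 2 <= m ([neutral_locus_submanifold]).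

    The analysis underneath is built for smoothness expressed by iterated
    directional derivatives.  The inverse function theorem
    ([inverse_function]) is obtained from the contraction principle: after
    normalising the derivative to the identity, id - f is 1/2-Lipschitz near
    the point, which makes f expanding and locally onto; smoothness of the
    inverse is bootstrapped from the formula Dg = (Df o g)^-1 and Cramer's
    rule. *)

Set Implicit Arguments.
Unset Strict Implicit.
Unset Printing Implicit Defensive.

Local Open Scope classical_set_scope.
Local Open Scope ring_scope.

(** * Calculus of C^k maps on open sets *)

Section differentiability.
Context {R : realType} {V W : normedModType R}.

(** Differentiability from the first-order estimate; the remaining proofs can
    then be written with inequalities instead of little-o terms. *)
Lemma differentiable_approx (f : V -> W) x (L : {linear V -> W}) :
  continuous L ->
  (forall e, 0 < e ->
     \forall h \near 0, `|f (h + x) - f x - L h| <= e * `|h|) ->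
  differentiable f x /\ ('d f x : V -> W) = L.
Proof.
move=> Lc fL.
have fE : f \o shift x = cst (f x) + L +o_ 0 id.
  apply/eqaddoP => _/posnumP[e] /=.
  have := fL _ [gt0 of e%:num]; apply: filterS => h /=.
  by rewrite [X in _ -> `|X| <= _](_ : _ = f (h + x) - f x - L h) // opprD addrA.
have dE := diff_unique Lc fE.
by split=> //; apply/diff_locallyP; rewrite dE.
Qed.

Lemma near_eq_differentiable (f g : V -> W) x :
  (\near x, f x = g x) -> differentiable f x -> differentiable g x.
Proof.
move=> fg df.
apply: (proj1 (@differentiable_approx g x ('d f x) _ _)).
  exact: diff_continuous.
move=> e e0.
have /diff_locally/eqaddoP/(_ _ e0) := df.
have fg0 : \forall h \near 0, f (h + x) = g (h + x).
  by move: fg; rewrite (near_shift 0) /=; apply: filterS => h; rewrite subr0.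
apply: filterS2 fg0 => h /= <-.
rewrite -(nbhs_singleton fg).
by rewrite [X in `|X| <= _ -> _](_ : _ = f (h + x) - f x - 'd f x h) // opprD addrA.
Qed.

End differentiability.

Section Ck_basic.
Context {R : realType}.
Implicit Types V W : normedModType R.

Lemma Ck_on_sub V W k (A B : set V) (f : V -> W) :
  A `<=` B -> Ck_on k B f -> Ck_on k A f.
Proof.
move=> AB; elim: k f => [|k IH] f /=; first by move=> H x /AB/H.
by case=> d H; split=> [x /AB/d//|v]; exact: IH.
Qed.

Lemma Ck_onW V W k (A : set V) (f : V -> W) : Ck_on k.+1 A f -> Ck_on k A f.
Proof.
elim: k f => [|k IH] f.
  by case=> d _ x /d; exact: differentiable_continuous.
by case=> d H; split=> // v; exact: IH.
Qed.

Lemma Ck_on_continuous V W k (A : set V) (f : V -> W) x :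
  Ck_on k A f -> A x -> {for x, continuous f}.
Proof. by elim: k => [|k IH] H; [exact: H|apply: IH; exact: Ck_onW]. Qed.

Lemma smooth_on_differentiable V W (A : set V) (f : V -> W) x :
  smooth_on A f -> A x -> differentiable f x.
Proof. by move=> /(_ 1%N)[+ _]; apply. Qed.

Lemma smooth_on_derive V W (A : set V) (f : V -> W) v :
  smooth_on A f -> smooth_on A ('D_v f).
Proof. by move=> H k; have [_] := H k.+1; apply. Qed.

Lemma smooth_on_continuous V W (A : set V) (f : V -> W) x :
  smooth_on A f -> A x -> {for x, continuous f}.
Proof. by move=> /(_ 0%N); exact: Ck_on_continuous. Qed.

Lemma open_near (T : topologicalType) (A : set T) x : open A -> A x ->
  \forall y \near x, A y.
Proof. by move=> oA Ax; apply: open_nbhs_nbhs. Qed.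

(** Openness is essential: a directional derivative at a point of A sees f on a
    whole neighbourhood of that point. *)
Lemma Ck_on_ext V W k (A : set V) (f g : V -> W) : open A ->
  (forall x, A x -> f x = g x) -> Ck_on k A f -> Ck_on k A g.
Proof.
move=> oA; elim: k f g => [|k IH] f g fg /=.
  move=> H x Ax; have := H x Ax; rewrite /prop_for /continuous_at (fg x Ax).
  apply: cvg_trans; apply: near_eq_cvg; near do apply: fg.
  exact: open_near.
case=> d H; split=> [x Ax|v].
  apply: (near_eq_differentiable _ (d x Ax)).
  by near do apply: fg; exact: open_near.
apply: IH (H v) => x Ax; apply: near_eq_derive.
by near do apply: fg; exact: open_near.
Unshelve. all: by end_near. Qed.

Lemma Ck_on_cst V W k (A : set V) (c : W) : Ck_on k A (fun=> c).
Proof.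
elim: k c => [|k IH] c /=; first by move=> x _; exact: cvg_cst.
split=> [x _|v]; first exact: differentiable_cst.
rewrite (_ : 'D_v (fun=> c) = fun=> 0) //.
by apply/funext => x; exact: derive_cst.
Qed.

Lemma derive_continuous_linear V W (L : {linear V -> W}) x v :
  continuous L -> 'D_v L x = L v.
Proof.
by move=> cL; rewrite deriveE ?diff_lin//; exact: linear_differentiable.
Qed.

Lemma Ck_on_linear V W k (A : set V) (L : {linear V -> W}) : continuous L ->
  Ck_on k A L.
Proof.
move=> cL; case: k => [|k] /=; first by move=> x _; exact: cL.
split=> [x _|v]; first exact: linear_differentiable.
rewrite (_ : 'D_v L = fun=> L v); first exact: Ck_on_cst.
by apply/funext => x; exact: derive_continuous_linear.
Qed.

Lemma differentiable_linear_comp V W W' (L : {linear W -> W'}) (f : V -> W) x :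
  continuous L -> differentiable f x -> differentiable (L \o f) x.
Proof.
move=> cL df; apply: differentiable_comp => //; exact: linear_differentiable.
Qed.

Lemma derive_linear_comp V W W' (L : {linear W -> W'}) (f : V -> W) x v :
  continuous L -> differentiable f x -> 'D_v (L \o f) x = L ('D_v f x).
Proof.
move=> cL df; have dL : differentiable L (f x).
  exact: linear_differentiable.
rewrite (deriveE _ df) deriveE; last exact: differentiable_comp.
by rewrite (diff_comp df dL) /= (diff_lin _ cL).
Qed.

Lemma Ck_on_linear_comp V W W' k (A : set V) (L : {linear W -> W'})
    (f : V -> W) : open A -> continuous L ->
  Ck_on k A f -> Ck_on k A (L \o f).
Proof.
move=> oA cL; elim: k f => [|k IH] f /=.
  by move=> H x Ax; apply: continuous_comp; [exact: H|exact: cL].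
case=> d H; split=> [x /d|v]; first exact: differentiable_linear_comp.
apply: (Ck_on_ext oA _ (IH _ (H v))) => x /d dfx.
by rewrite derive_linear_comp.
Qed.

(** Precomposition with an affine map needs no basis expansion, because
    D_v (f (L x + b)) is the derivative of f in the fixed direction L v; this
    allows an arbitrary normed module V' in the middle. *)
Lemma Ck_on_affine_comp V V' W k (A : set V) (B : set V') (L : {linear V -> V'})
    (b : V') (f : V' -> W) : open A -> continuous L ->
  (forall x, A x -> B (L x + b)) ->
  Ck_on k B f -> Ck_on k A (fun x => f (L x + b)).
Proof.
move=> oA cL AB.
have dL x : is_diff x (fun x => L x + b) L.
  have dLx : is_diff x L L.
    by apply: DiffDef; [exact: linear_differentiable|exact: diff_lin].
  by apply: is_diff_eq; apply/funext => y; rewrite /= addr0.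
elim: k f => [|k IH] f /=.
  move=> H x Ax; apply: (@continuous_comp _ _ _ (fun x => L x + b) f).
    by apply: differentiable_continuous; case: (dL x).
  exact: H (AB _ Ax).
case=> d H; have dc x : A x -> differentiable (fun x => f (L x + b)) x.
  move=> Ax; apply: (@differentiable_comp _ _ _ _ (fun x => L x + b) f).
    by case: (dL x).
  exact: d (AB _ Ax).
split=> // v.
apply: (Ck_on_ext oA _ (IH _ (H (L v)))) => x Ax /=.
have dfx := d _ (AB _ Ax).
rewrite (deriveE _ dfx) (deriveE _ (dc _ Ax)).
rewrite (@diff_comp _ _ _ _ (fun x => L x + b) f)//=; first by rewrite diff_val.
Qed.

Lemma Ck_onD V W k (A : set V) (f g : V -> W) : open A ->
  Ck_on k A f -> Ck_on k A g -> Ck_on k A (fun x => f x + g x).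
Proof.
move=> oA; elim: k f g => [|k IH] f g /=.
  by move=> Hf Hg x Ax; apply: cvgD; [exact: Hf|exact: Hg].
move=> [df Hf] [dg Hg]; split=> [x Ax|v].
  by apply: differentiableD; [exact: df|exact: dg].
apply: (Ck_on_ext oA _ (IH _ _ (Hf v) (Hg v))) => x Ax /=.
by rewrite deriveD//; apply: diff_derivable; [exact: df|exact: dg].
Qed.

Lemma Ck_onM V k (A : set V) (f g : V -> R) : open A ->
  Ck_on k A f -> Ck_on k A g -> Ck_on k A (fun x => f x * g x).
Proof.
move=> oA; elim: k f g => [|k IH] f g /=.
  by move=> Hf Hg x Ax; apply: cvgM; [exact: Hf|exact: Hg].
move=> Cf Cg; have [df Hf] := Cf; have [dg Hg] := Cg; split=> [x Ax|v].
  by apply: differentiableM; [exact: df|exact: dg].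
apply: (Ck_on_ext oA _ (Ck_onD oA (IH _ _ (Ck_onW Cf) (Hg v))
                                  (IH _ _ (Ck_onW Cg) (Hf v)))) => x Ax /=.
by rewrite deriveM//; apply: diff_derivable; [exact: df|exact: dg].
Qed.

Lemma Ck_onV V k (A : set V) (f : V -> R) : open A ->
  (forall x, A x -> f x != 0) ->
  Ck_on k A f -> Ck_on k A (fun x => (f x)^-1).
Proof.
move=> oA f0; elim: k => [|k IH] /=.
  by move=> Hf x Ax; apply: cvgV; [exact: f0|exact: Hf].
move=> Cf; have [df Hf] := Cf; split=> [x Ax|v].
  by apply: differentiableV; [exact: df|exact: f0].
have CV := IH (Ck_onW Cf).
have := Ck_onM oA (Ck_on_cst k A (-1 : R)) (Ck_onM oA (Ck_onM oA CV CV) (Hf v)).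
apply: Ck_on_ext => // x Ax.
rewrite deriveV ?f0//; last by apply: diff_derivable; exact: df.
by rewrite expr2 invfM scaleNr mulN1r.
Qed.

Lemma Ck_on_sum V W k (A : set V) I (s : seq I) (P : pred I)
    (F : I -> V -> W) : open A ->
  (forall i, P i -> Ck_on k A (F i)) ->
  Ck_on k A (fun x => \sum_(i <- s | P i) F i x).
Proof.
move=> oA H; elim: s => [|i s IH].
  by rewrite (_ : (fun _ => _) = fun=> 0);
    [exact: Ck_on_cst|apply/funext => x; rewrite big_nil].
case Pi: (P i); last first.
  by rewrite (_ : (fun _ => _) = (fun x => \sum_(i <- s | P i) F i x))//;
    apply/funext => x; rewrite big_cons Pi.
rewrite (_ : (fun _ => _) = (fun x => F i x + \sum_(i <- s | P i) F i x)).
  by apply: Ck_onD => //; exact: H.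
by apply/funext => x; rewrite big_cons Pi.
Qed.

Lemma Ck_on_prod V k (A : set V) I (s : seq I) (P : pred I)
    (F : I -> V -> R) : open A ->
  (forall i, P i -> Ck_on k A (F i)) ->
  Ck_on k A (fun x => \prod_(i <- s | P i) F i x).
Proof.
move=> oA H; elim: s => [|i s IH].
  by rewrite (_ : (fun _ => _) = fun=> 1);
    [exact: Ck_on_cst|apply/funext => x; rewrite big_nil].
case Pi: (P i); last first.
  by rewrite (_ : (fun _ => _) = (fun x => \prod_(i <- s | P i) F i x))//;
    apply/funext => x; rewrite big_cons Pi.
rewrite (_ : (fun _ => _) = (fun x => F i x * \prod_(i <- s | P i) F i x)).
  by apply: Ck_onM => //; exact: H.
by apply/funext => x; rewrite big_cons Pi.
Qed.

Lemma derive_comp (U V W : normedModType R) (g : U -> V) (f : V -> W) x v :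
  differentiable g x -> differentiable f (g x) ->
  'D_v (f \o g) x = 'D_('D_v g x) f (g x).
Proof.
move=> dg df; have dfg : differentiable (f \o g) x.
  exact: differentiable_comp.
by rewrite (deriveE _ dfg) (deriveE _ dg) (deriveE _ df) (diff_comp dg df).
Qed.

End Ck_basic.

Section row_vectors.
Context {R : realType}.
Implicit Types V W : normedModType R.

(** Lets a concrete function proved linear be used where a bundled linear map
    is expected. *)
Lemma linear_bundle V W (f : V -> W) :
  linear f -> exists L : {linear V -> W}, f = L.
Proof.
move=> lf; pose B := GRing.isLinear.Build _ _ _ _ _ lf.
by exists (HB.pack f B : {linear _ -> _}).
Qed.

Lemma rV_linear_continuous n W (L : {linear 'rV[R]_n -> W}) : continuous L.
Proof.
have -> : (L : _ -> _) = fun x : 'rV[R]_n => \sum_i x 0 i *: L (delta_mx 0 i).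
  apply/funext => x; rewrite [in LHS](row_sum_delta x) linear_sum.
  by apply: eq_bigr => i _; rewrite linearZ.
move=> x; apply: (@Ck_on_sum _ _ _ 0%N setT) => //; first exact: openT.
move=> i _ y _; by have /cvgZr_tmp := @coord_continuous R 1 n 0 i y; apply.
Qed.

Lemma Ck_on_rV_linear n W k (A : set 'rV[R]_n) (L : {linear 'rV[R]_n -> W}) :
  Ck_on k A L.
Proof. by apply: Ck_on_linear; exact: rV_linear_continuous. Qed.

Lemma derive_rV_sum n W (f : 'rV[R]_n -> W) x v : differentiable f x ->
  'D_v f x = \sum_i v 0 i *: 'D_(delta_mx 0 i) f x.
Proof.
move=> df; rewrite deriveE// [in LHS](row_sum_delta v) linear_sum.
by apply: eq_bigr => i _; rewrite linearZ deriveE.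
Qed.

Lemma Ck_on_coord V n k (A : set V) (f : V -> 'rV[R]_n) j : open A ->
  Ck_on k A f -> Ck_on k A (fun x => f x 0 j).
Proof.
move=> oA Cf.
have lc : linear (fun x : 'rV[R]_n => x 0 j).
  by move=> a x y; rewrite !mxE.
have [L LE] := linear_bundle lc.
have -> : (fun x => f x 0 j) = L \o f by rewrite -LE.
by apply: Ck_on_linear_comp => //; exact: rV_linear_continuous.
Qed.

Lemma Ck_on_row V n k (A : set V) (f : V -> 'rV[R]_n) : open A ->
  (forall j, Ck_on k A (fun x => f x 0 j)) -> Ck_on k A f.
Proof.
move=> oA Cf.
have -> : f = fun x => \sum_j f x 0 j *: delta_mx 0 j.
  by apply/funext => x; exact: row_sum_delta.
apply: Ck_on_sum => // j _.
have lc : linear (fun a : R => a *: (delta_mx 0 j : 'rV[R]_n)).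
  by move=> a x y; rewrite scalerDl scalerA.
have [L LE] := linear_bundle lc.
have -> : (fun x => f x 0 j *: delta_mx 0 j) = L \o (fun x => f x 0 j).
  by rewrite -LE.
apply: Ck_on_linear_comp => //; rewrite -LE => a.
exact: scalel_continuous.
Qed.

Lemma derive_coord V n (f : V -> 'rV[R]_n) x v j : differentiable f x ->
  'D_v f x 0 j = 'D_v (fun x => f x 0 j) x.
Proof. by move=> df; rewrite derive_mx ?mxE//; exact: diff_derivable. Qed.

(** Chain rule at the level of directional derivatives: the inner derivative
    is expanded on the canonical basis, so that the derivative of a composite
    is again built from products and composites of lower order. *)
Lemma derive_rV_comp V n (g : V -> 'rV[R]_n) (f : 'rV[R]_n -> R) x v :
  differentiable g x -> differentiable f (g x) ->
  'D_v (f \o g) x = \sum_i 'D_v (fun y => g y 0 i) x * 'D_(delta_mx 0 i) f (g x).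
Proof.
move=> dg df; rewrite deriveE; last exact: differentiable_comp.
rewrite diff_comp//= -deriveE// derive_rV_sum//; apply: eq_bigr => i _.
by rewrite -deriveE// derive_coord.
Qed.

(** Induction on k: the chain rule writes D_v (f o g) as a sum of products of a
    derivative of g with (D_i f) o g, to which the induction hypothesis
    applies. *)
Lemma Ck_on_comp V n k (A : set V) (B : set 'rV[R]_n)
    (g : V -> 'rV[R]_n) (f : 'rV[R]_n -> R) : open A ->
  (forall x, A x -> B (g x)) ->
  Ck_on k A g -> Ck_on k B f -> Ck_on k A (f \o g).
Proof.
move=> oA gAB; elim: k f => [|k IH] f.
  move=> Cg Cf x Ax; apply: continuous_comp; first exact: Cg.
  by apply: Cf; exact: gAB.
move=> Cg Cf; have [dg Hg] := Cg; have [df Hf] := Cf.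
have df' x : A x -> differentiable f (g x) by move=> Ax; exact/df/gAB.
split=> [x Ax|v]; first by apply: differentiable_comp; [exact: dg|exact: df'].
have C : Ck_on k A (fun x => \sum_i 'D_v (fun y => g y 0 i) x *
    ('D_(delta_mx 0 i) f \o g) x).
  apply: Ck_on_sum => // i _; apply: Ck_onM => //.
    by have [_ +] := Ck_on_coord i oA Cg; apply.
  by apply: IH; [exact: Ck_onW|exact: Hf].
apply: (Ck_on_ext oA _ C) => x Ax; rewrite derive_rV_comp//; first exact: dg.
exact: df'.
Qed.

Lemma Ck_on_det V n k (A : set V) (M : V -> 'M[R]_n) : open A ->
  (forall i j, Ck_on k A (fun x => M x i j)) ->
  Ck_on k A (fun x => \det (M x)).
Proof.
move=> oA CM; apply: Ck_on_sum => // s _; apply: Ck_onM => //.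
  exact: Ck_on_cst.
by apply: Ck_on_prod.
Qed.

(** Cramer's rule: the entries of the inverse are rational in those of M. *)
Lemma Ck_on_invmx V n k (A : set V) (M : V -> 'M[R]_n) : open A ->
  (forall i j, Ck_on k A (fun x => M x i j)) ->
  (forall x, A x -> M x \in unitmx) ->
  forall i j, Ck_on k A (fun x => invmx (M x) i j).
Proof.
move=> oA CM uM i j.
have C : Ck_on k A (fun x => (\det (M x))^-1 * cofactor (M x) j i).
  apply: Ck_onM => //.
    apply: Ck_onV => //; last exact: Ck_on_det.
    by move=> x /uM; rewrite unitmxE unitfE.
  apply: Ck_onM => //; first exact: Ck_on_cst.
  apply: Ck_on_det => // i' j'.
  rewrite (_ : (fun _ => _) = fun x => M x (lift j i') (lift i j'))//.
  by apply/funext => x; rewrite !mxE.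
by apply: (Ck_on_ext oA _ C) => x Ax; rewrite /invmx uM// !mxE.
Qed.

Lemma smooth_on_rV_linear m (W : normedModType R) (A : set 'rV[R]_m)
    (f : 'rV[R]_m -> W) : linear f -> smooth_on A f.
Proof.
by move=> lf k; have [L ->] := linear_bundle lf; exact: Ck_on_rV_linear.
Qed.

Lemma rV_linear_continuous_fun m (W : normedModType R) (f : 'rV[R]_m -> W) :
  linear f -> continuous f.
Proof.
by move=> lf; have [L ->] := linear_bundle lf; exact: rV_linear_continuous.
Qed.

Lemma derive_rV_linear m (W : normedModType R) (f : 'rV[R]_m -> W) x v :
  linear f -> 'D_v f x = f v.
Proof.
move=> lf; have [L ->] := linear_bundle lf.
by rewrite derive_continuous_linear//; exact: rV_linear_continuous.
Qed.

Lemma derive_rV_linear_comp (V : normedModType R) m (W : normedModType R)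
    (g : V -> 'rV[R]_m) (f : 'rV[R]_m -> W) x v :
  linear f -> differentiable g x ->
  'D_v (fun y => f (g y)) x = f ('D_v g x).
Proof.
move=> lf dg; have [L LE] := linear_bundle lf; rewrite LE.
by rewrite (@derive_linear_comp _ _ _ _ L g)//; exact: rV_linear_continuous.
Qed.

Lemma smooth_on_comp (V : normedModType R) m n (A : set V) (B : set 'rV[R]_m)
    (g : V -> 'rV[R]_m) (f : 'rV[R]_m -> 'rV[R]_n) : open A ->
  (forall x, A x -> B (g x)) -> open B ->
  smooth_on A g -> smooth_on B f -> smooth_on A (f \o g).
Proof.
move=> oA gAB oB sg sf k; apply: Ck_on_row => // j.
have Cf : Ck_on k B (fun x => f x 0 j) by exact: Ck_on_coord.
exact: Ck_on_comp oA gAB (sg k) Cf.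
Qed.

End row_vectors.

(** * Inverse function theorem *)

Section inverse_function.
Context {R : realType}.

Lemma rV_fixed_point n (U : set 'rV[R]_n) (f : 'rV[R]_n -> 'rV[R]_n) :
  closed U -> U !=set0 -> (forall x, U x -> U (f x)) ->
  (forall x y, U x -> U y -> `|f x - f y| <= 2^-1 * `|x - y|) ->
  exists2 p, U p & p = f p.
Proof.
move=> cU U0 fU lf.
pose X : completeNormedModType R :=
  HB.pack 'rV[R]_n (Complete.class 'rV[R]_n).
pose F : {fun (U : set X) >-> (U : set X)} :=
  mkfun (fU : {homo f : x / U x >-> U x}).
apply: (@banach_fixed_point _ X U F) => //.
exists (2^-1)%:nng; split => /=; first by rewrite invf_lt1 ?ltr1n.
by move=> [x y] [/= Ux Uy]; exact: lf.
Qed.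

Lemma rV_norm_le n (x : 'rV[R]_n) c : 0 <= c ->
  (forall j, `|x 0 j| <= c) -> `|x| <= c.
Proof.
move=> c0 xc; rewrite /Num.Def.normr /= mx_normrE.
by apply: bigmax_le => // -[i j] _ /=; rewrite ord1.
Qed.

Lemma rV_coord_le n (x : 'rV[R]_n) j : `|x 0 j| <= `|x|.
Proof.
by rewrite [leRHS]/Num.Def.normr /= mx_normrE (le_bigmax _ _ (0, j)).
Qed.

Lemma is_derive_line (V W : normedModType R) (f : V -> W) (y w : V) (t : R) :
  differentiable f (t *: w + y) ->
  is_derive t 1 (fun s : R => f (s *: w + y)) ('D_w f (t *: w + y)).
Proof.
move=> df.
have dl : is_diff t (fun s : R => s *: w + y) (fun s : R => s *: w).
  by apply: is_diff_eq; apply/funext => s; rewrite /= addr0.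
have dc : differentiable (fun s : R => f (s *: w + y)) t.
  by apply: (@differentiable_comp _ _ _ _ (fun s : R => s *: w + y) f);
    case: dl.
apply: DeriveDef; first exact: diff_derivable.
rewrite !deriveE// (@diff_comp _ _ _ _ (fun s : R => s *: w + y) f)//.
  by rewrite /= diff_val scale1r.
Qed.

(** The n * n first partial derivatives are continuous and finitely many, so
    they are all close to their values at a on one ball; summing the n terms of
    the basis expansion of D_v f turns this into a bound in operator norm. *)
Lemma near_derive_identity n (U : set 'rV[R]_n) (f : 'rV[R]_n -> 'rV[R]_n) a :
  open U -> U a -> Ck_on 1 U f -> (forall v, 'D_v f a = v) ->
  exists r, [/\ 0 < r, ball a r `<=` U &
    forall x v, ball a r x -> `|v - 'D_v f x| <= 2^-1 * `|v|].
Proof.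
move=> oU Ua [df Cf] fa.
(* n e <= 1/2, also when n = 0 *)
pose e : R := (2 * n.+1%:R)^-1.
have e0 : 0 < e by rewrite invr_gt0 mulr_gt0.
pose P (i j : 'I_n) (x : 'rV[R]_n) : Prop :=
  `|(delta_mx 0 i : 'rV[R]_n) 0 j - 'D_(delta_mx 0 i) f x 0 j| <= e.
have near_P i j : \forall x \near a, P i j x.
  have c := Cf (delta_mx 0 i) a Ua.
  have cj : {for a, continuous (fun x => 'D_(delta_mx 0 i) f x 0 j)}.
    apply: (@continuous_comp _ _ _ ('D_(delta_mx 0 i) f)
      (fun M : 'rV[R]_n => M 0 j)); first exact: c.
    exact: coord_continuous.
  by have /cvgrPdist_le/(_ e e0) := cj; rewrite fa.
have near_e : \forall x \near a, U x /\ forall i j, P i j x.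
  apply: filterI; first by move: (open_near oU Ua).
  apply: (@filter_forall _ _ (fun i x => forall j, P i j x) (nbhs a)) => i.
  exact: (@filter_forall _ _ (P i) (nbhs a) _ (near_P i)).
have [r /= r0 rU] := (nbhs_ballP a _).1 near_e.
exists r; split=> // [x /rU[]//|x v /rU[Ux xe]].
apply: rV_norm_le => [|j]; first by rewrite mulr_ge0.
rewrite (derive_rV_sum _ (df x Ux)) {1}(row_sum_delta v) -sumrB summxE.
apply: le_trans (ler_norm_sum _ _ _) _.
have le1 i : true -> `|(v 0 i *: delta_mx 0 i - v 0 i *: 'D_(delta_mx 0 i) f x) 0 j|
    <= `|v| * e.
  move=> _; rewrite -scalerBr mxE normrM ler_pM//; first exact: rV_coord_le.
  by have := xe i j; rewrite /P !mxE.
apply: le_trans (ler_sum _ le1) _.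
rewrite sumr_const card_ord -[leLHS]mulr_natr -mulrA mulrC ler_wpM2r//.
rewrite /e invfM -mulrA ler_piMr ?invr_ge0// mulrC.
by rewrite ler_pdivrMr ?ltr0n// mul1r ler_nat.
Unshelve. all: by end_near. Qed.

(** Mean value theorem, applied to each coordinate of id - f along the segment
    from y to x, which stays in the ball by convexity. *)
Lemma contraction_defect n (f : 'rV[R]_n -> 'rV[R]_n) a r :
  (forall x, ball a r x -> differentiable f x) ->
  (forall x v, ball a r x -> `|v - 'D_v f x| <= 2^-1 * `|v|) ->
  forall x y, ball a r x -> ball a r y ->
    `|(x - f x) - (y - f y)| <= 2^-1 * `|x - y|.
Proof.
move=> df nf x y ax ay.
apply: rV_norm_le => [|j]; first by rewrite mulr_ge0.
pose w := x - y; pose u z := (z - f z) 0 j.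
have seg (t : R) : 0 <= t <= 1 -> ball a r (t *: w + y).
  move=> /andP[t0 t1]; move: ax ay; rewrite -ball_normE /= => ax ay.
  have -> : a - (t *: w + y) = t *: (a - x) + (1 - t) *: (a - y).
    rewrite /w scalerBl scale1r !scalerBr opprD.
    by apply/rowP => k; rewrite !mxE; ring.
  apply: le_lt_trans (ler_normD _ _) _; rewrite !normrZ.
  rewrite (ger0_norm t0) (@ger0_norm _ (1 - t)) ?subr_ge0//.
  set p := `|a - x| in ax *; set q := `|a - y| in ay *.
  have [t10|t10] := eqVneq t 0; first by rewrite t10; lra.
  have tp : 0 < t by rewrite lt_def t10.
  have : t * p < t * r by rewrite ltr_pM2l.
  have : (1 - t) * q <= (1 - t) * r by rewrite ler_wpM2l ?subr_ge0// ltW.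
  lra.
have du z : ball a r z -> differentiable u z.
  move=> az; apply: (@differentiable_comp _ _ _ _ (fun z => z - f z)
    (fun M : 'rV[R]_n => M 0 j)); last exact: differentiable_coord.
  by apply: differentiableB => //; exact: df.
have Du z v : ball a r z -> 'D_v u z = (v - 'D_v f z) 0 j.
  move=> az; rewrite /u -derive_coord; last first.
    by apply: differentiableB => //; exact: df.
  rewrite deriveB ?derive_id//; apply: diff_derivable; exact: df.
have [| |c] := @MVT R (fun t => u (t *: w + y))
    (fun t => 'D_w u (t *: w + y)) 0 1 ltr01.
  move=> t; rewrite in_itv /= => /andP[t0 t1].
  by apply: is_derive_line; apply/du/seg; rewrite !ltW.
- apply: continuous_in_subspaceT => t.
  rewrite inE /= in_itv /= => t01.
  apply: differentiable_continuous; apply/derivable1_diffP.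
  by have [] := is_derive_line (du _ (seg t t01)).
- rewrite in_itv /= => /andP[c0 c1].
  rewrite scale1r scale0r add0r subr0 mulr1 /w subrK => E.
  have -> : ((x - f x) - (y - f y)) 0 j = u x - u y by rewrite /u !mxE.
  have ac : ball a r (c *: w + y).
    by apply: seg; rewrite !ltW.
  rewrite E Du//; apply: le_trans (nf _ _ ac); exact: rV_coord_le.
Qed.

(** Solving f x = y amounts to finding a fixed point of x |-> y + (x - f x). *)
Lemma contraction_surjective n (f : 'rV[R]_n -> 'rV[R]_n) a r :
  (forall x y, ball a r x -> ball a r y ->
    `|(x - f x) - (y - f y)| <= 2^-1 * `|x - y|) ->
  forall y, ball (f a) (r / 2) y -> exists2 x, ball a r x & f x = y.
Proof.
move=> lf y By.
have fay : `|f a - y| < r / 2 by move: By; rewrite -ball_normE.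
(* the smallest radius for which the closed ball around a is preserved *)
pose s := 2 * `|f a - y|.
have sr : s < r by rewrite /s; lra.
have s0 : 0 <= s by rewrite mulr_ge0.
have r0 : 0 < r by exact: le_lt_trans sr.
have br x : `|a - x| <= s -> ball a r x.
  by rewrite -ball_normE /= => /le_lt_trans; apply.
have aa : ball a r a by exact: ballxx.
have [||x xs|x z /= xs zs|x /= xs xE] :=
    @rV_fixed_point n [set x | `|a - x| <= s] (fun x => y + (x - f x)).
- rewrite (_ : [set _ | _] = closed_ball_ Num.norm a s) //.
  exact: closed_closed_ball_.
- by exists a; rewrite /= subrr normr0.
- have := lf _ _ aa (br _ xs) => H.
  rewrite /= (_ : a - _ = (f a - y) + ((a - f a) - (x - f x))); last first.
    by apply/rowP => k; rewrite !mxE; ring.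
  apply: le_trans (ler_normD _ _) _.
  have xs' : `|a - x| <= s := xs.
  have -> : `|f a - y| = 2^-1 * s by rewrite /s; lra.
  lra.
- rewrite opprD addrACA subrr add0r; apply: lf; exact: br.
exists x; first exact: br.
by apply: (addrI (x - f x)); rewrite [RHS]addrC -xE subrK.
Qed.

Lemma jacobianE m n (f : 'rV[R]_m -> 'rV[R]_n) x i j : differentiable f x ->
  jacobian f x i j = 'D_(delta_mx 0 i) f x 0 j.
Proof. by move=> df; rewrite deriveE// /jacobian /lin1_mx mxE. Qed.

(** With h = g (y + k) - g y, the expansion k = h J + o(h) of f gives
    h = k J^-1 + o(h), and the Lipschitz bound on g turns o(h) into o(k). *)
Lemma expanding_inverse_differentiable n (A B : set 'rV[R]_n)
    (f g : 'rV[R]_n -> 'rV[R]_n) y :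
  open B -> (forall y, B y -> A (g y) /\ f (g y) = y) ->
  (forall y z, B y -> B z -> `|g y - g z| <= 2 * `|y - z|) ->
  differentiable f (g y) -> jacobian f (g y) \in unitmx -> B y ->
  differentiable g y /\
  ('d g y : _ -> _) = fun v => v *m invmx (jacobian f (g y)).
Proof.
move=> oB fg lg df uJ By; set J := jacobian f (g y) in uJ *.
have lJ : linear (fun v : 'rV[R]_n => v *m invmx J).
  by move=> a u v; rewrite mulmxDl scalemxAl.
have [L LE] := linear_bundle lJ; rewrite LE.
have cL : continuous L by exact: rV_linear_continuous.
apply: (differentiable_approx cL) => e e0.
have [C C0 LC] := linear_lipschitz cL.
have d0 : 0 < e / (2 * C) by rewrite divr_gt0// mulr_gt0.
have /diff_locally/eqaddoP/(_ _ d0)/nbhs_ballP[r /= r0 fr] := df.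
have [s /= s0 sB] := (nbhs_ballP y _).1 (open_near oB By).
have near0 (d : R) : 0 < d -> \forall k \near (0 : 'rV[R]_n), `|k| < d.
  by move=> ?; exact: pseudometric_normed_Zmodule.nbhs0_lt.
near=> k.
have Bk : B (k + y).
  apply: sB; rewrite -ball_normE /= opprD addrCA subrr addr0 normrN.
  by near: k; exact: near0.
have kr : `|k| < r / 2 by near: k; apply: near0; rewrite divr_gt0.
pose h := g (k + y) - g y.
have hk : `|h| <= 2 * `|k| by have := lg _ _ Bk By; rewrite addrK.
have := fr h; rewrite -ball_normE /= sub0r normrN => /(_ _).
have hr : `|h| < r by lra.
move=> /(_ hr).
rewrite [X in `|X| <= _ -> _](_ : _ = k - h *m J); last first.
  rewrite -[_ h]/(f (h + g y) - (f (g y) + 'd f (g y) h)) subrK.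
  rewrite (fg _ Bk).2 (fg _ By).2 -deriveE// deriveEjacobian//.
  by rewrite opprD addrA addrK.
move=> fh.
have -> : h - L k = - L (k - h *m J).
  by rewrite linearB -!LE mulmxK// opprB.
rewrite normrN; apply: le_trans (LC _) _.
have : C * `|k - h *m J| <= C * (e / (2 * C) * `|h|) by rewrite ler_pM2l.
move=> /le_trans; apply.
have -> : C * (e / (2 * C) * `|h|) = e / 2 * `|h|.
  by field; rewrite gt_eqF.
have : e / 2 * `|h| <= e / 2 * (2 * `|k|) by rewrite ler_pM2l// divr_gt0.
by move=> /le_trans; apply; rewrite mulrA divfK.
Unshelve. all: by end_near. Qed.

(** Bootstrap: if g is C^k then so is y |-> (J_f (g y))^-1, which is the
    derivative of g; hence g is C^(k+1). *)
Lemma expanding_inverse_smooth n (A B : set 'rV[R]_n)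
    (f g : 'rV[R]_n -> 'rV[R]_n) :
  open A -> open B -> smooth_on A f ->
  (forall y, B y -> A (g y) /\ f (g y) = y) ->
  (forall y z, B y -> B z -> `|g y - g z| <= 2 * `|y - z|) ->
  (forall x, A x -> jacobian f x \in unitmx) ->
  smooth_on B g.
Proof.
move=> oA oB sf fg lg uJ.
have dg y : B y -> differentiable g y /\
    ('d g y : _ -> _) = fun v => v *m invmx (jacobian f (g y)).
  move=> By; have [Ag _] := fg y By.
  apply: (expanding_inverse_differentiable oB fg lg) => //.
    exact: smooth_on_differentiable sf Ag.
  exact: uJ.
elim=> [|k IH].
  by move=> y /dg[d _]; exact: differentiable_continuous.
split=> [y /dg[]//|v].
have CJ i j : Ck_on k B (fun y => jacobian f (g y) i j).
  have C : Ck_on k B ((fun x => 'D_(delta_mx 0 i) f x 0 j) \o g).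
    apply: (Ck_on_comp (B := A) oB) => //; first by move=> y /fg[].
    by apply: Ck_on_coord => //; apply: smooth_on_derive.
  apply: (Ck_on_ext oB _ C) => y /fg[Ag _]; rewrite jacobianE//.
  exact: smooth_on_differentiable sf Ag.
have CI := Ck_on_invmx oB CJ (fun y By => uJ _ (fg y By).1).
apply: Ck_on_row => // j.
have C : Ck_on k B (fun y => \sum_i v 0 i * invmx (jacobian f (g y)) i j).
  apply: Ck_on_sum => // i _; apply: Ck_onM => //; exact: Ck_on_cst.
apply: (Ck_on_ext oB _ C) => y /dg[d dE].
by rewrite deriveE// dE mxE.
Qed.

(** On a small ball f is expanding, |x - y| <= 2 |f x - f y|, and reaches every
    point of the ball of half the radius around f a; the neighbourhood W is the
    preimage of that half ball, so that its image is exactly the half ball. *)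
Lemma inverse_function_identity n (U : set 'rV[R]_n)
    (f : 'rV[R]_n -> 'rV[R]_n) a :
  open U -> U a -> smooth_on U f -> (forall v, 'D_v f a = v) ->
  exists W g, [/\ open_nbhs a W, W `<=` U, open (f @` W),
    smooth_on (f @` W) g & forall x, W x -> g (f x) = x].
Proof.
move=> oU Ua sf fa.
have [r [r0 rU fr]] := near_derive_identity oU Ua (sf 1%N) fa.
have df x : ball a r x -> differentiable f x.
  by move=> /rU; exact: smooth_on_differentiable.
have lf := contraction_defect df fr.
have sur := contraction_surjective lf.
have exp x y : ball a r x -> ball a r y -> `|x - y| <= 2 * `|f x - f y|.
  move=> ax ay; have := lf _ _ ax ay.
  have : `|x - y| <= `|(x - f x) - (y - f y)| + `|f x - f y|.
    apply: le_trans (ler_normD _ _); rewrite [leRHS](_ : _ = `|x - y|)//.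
    by congr `|_|; apply/rowP => k; rewrite !mxE; ring.
  lra.
pose W := ball a r `&` f @^-1` ball (f a) (r / 2).
have fW : f @` W = ball (f a) (r / 2).
  apply/seteqP; split=> [_ [x [_ ?] <-]//|y By].
  by have [x ax fx] := sur _ By; exists x => //; split => //=; rewrite fx.
have oW : open W.
  rewrite openE => x [ax fx].
  have cf : {for x, continuous f} by apply/differentiable_continuous/df.
  have near_a : nbhs x (ball a r).
    by apply: open_nbhs_nbhs; split=> //; exact: ball_open.
  have near_f : nbhs (f x) (ball (f a) (r / 2)).
    by apply: open_nbhs_nbhs; split=> //; apply: ball_open; rewrite divr_gt0.
  exact: filterI near_a (cf _ near_f).
have gP y : exists x, ball (f a) (r / 2) y -> W x /\ f x = y.
  have [By|nB] := pselect (ball (f a) (r / 2) y); last by exists 0.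
  by have [x ax fx] := sur _ By; exists x => _; split=> //; split=> //=; rewrite fx.
have [g gE] := choice gP.
exists W, g; rewrite fW; split.
- split=> //; split; first exact: ballxx.
  by apply: ballxx; rewrite divr_gt0.
- by move=> x [/rU].
- exact: ball_open.
- apply: (expanding_inverse_smooth oW (ball_open _ _) _ gE).
  + by move=> k; apply: Ck_on_sub (sf k) => x [/rU].
  + move=> y z By Bz; have [[ay _] fy] := gE _ By.
    by have [[az _] fz] := gE _ Bz; have := exp _ _ ay az; rewrite fy fz.
  (* |v - D_v f x| <= |v|/2 forces v = 0 as soon as D_v f x = 0 *)
  + move=> x [ax _]; rewrite -row_free_unit; apply: inj_row_free => v vJ.
    have := fr x v ax; rewrite deriveEjacobian ?vJ ?subr0; last exact: df.
    move=> vv; have : `|v| <= 0 by lra.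
    by rewrite normr_le0 => /eqP.
- move=> x Wx; have Bx : ball (f a) (r / 2) (f x) by case: Wx.
  have [[ag _] fg] := gE _ Bx; case: Wx => ax _.
  have := exp _ _ ag ax; rewrite fg subrr normr0 mulr0 normr_le0 subr_eq0.
  by move/eqP.
Qed.

(** Reduces to derivative the identity by composing f with the inverse of E on
    the target side. *)
Theorem inverse_function n (U : set 'rV[R]_n)
    (f : 'rV[R]_n -> 'rV[R]_n) a (E : 'M[R]_n) :
  open U -> U a -> smooth_on U f -> E \in unitmx ->
  (forall v, 'D_v f a = v *m E) ->
  exists W g, [/\ open_nbhs a W, W `<=` U, open (f @` W),
    smooth_on (f @` W) g & forall x, W x -> g (f x) = x].
Proof.
move=> oU Ua sf uE fa.
have lE : linear (fun v : 'rV[R]_n => v *m E).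
  by move=> c u v; rewrite mulmxDl scalemxAl.
have lF : linear (fun v : 'rV[R]_n => v *m invmx E).
  by move=> c u v; rewrite mulmxDl scalemxAl.
have [LE EE] := linear_bundle lE; have [LF FE] := linear_bundle lF.
have [|v|W [g [oW WU oI sg gf]]] :=
    @inverse_function_identity n U (LF \o f) a oU Ua.
- move=> k; apply: Ck_on_linear_comp => //; exact: rV_linear_continuous.
- have df := smooth_on_differentiable sf Ua.
  rewrite derive_linear_comp//; last exact: rV_linear_continuous.
  by rewrite fa -FE mulmxK.
have oWI : f @` W = LF @^-1` ((LF \o f) @` W).
  apply/seteqP; split=> [_ [x Wx <-]|y [x Wx /= fxy]]; first by exists x.
  by exists x => //; apply: (can_inj (mulmxKV uE)); move: fxy; rewrite /= -FE.
exists W, (g \o LF); split => //.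
- by rewrite oWI; apply: open_comp => // x _; exact: rV_linear_continuous.
- move=> k; have oD : open (f @` W).
    by rewrite oWI; apply: open_comp => // x _; exact: rV_linear_continuous.
  have -> : g \o LF = fun x => g (LF x + 0).
    by apply/funext => x; rewrite addr0.
  apply: (Ck_on_affine_comp oD _ _ (sg k)); first exact: rV_linear_continuous.
  by move=> x; rewrite oWI addr0.
Qed.

End inverse_function.

(** * Submersions and implicit functions *)

Section submersion.
Context {R : realType}.

Lemma linear_mulmxr m n (M : 'M[R]_(m, n)) :
  linear (fun v : 'rV[R]_m => v *m M).
Proof. by move=> c u v; rewrite mulmxDl scalemxAl. Qed.

Lemma Ck_on_mulmxr (V : normedModType R) m n k (A : set V)
    (f : V -> 'rV[R]_m) (M : 'M[R]_(m, n)) : open A ->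
  Ck_on k A f -> Ck_on k A (fun x => f x *m M).
Proof.
move=> oA Cf; have [L LE] := linear_bundle (linear_mulmxr M).
have -> : (fun x => f x *m M) = L \o f by rewrite -LE.
by apply: Ck_on_linear_comp => //; exact: rV_linear_continuous.
Qed.

(** Right multiplication by the partial identity keeps the first k
    coordinates. *)
Lemma mul_pid_mx_eq0 m k (z : 'rV[R]_m) :
  z *m (pid_mx k : 'M[R]_(m, k)) = 0 <->
  forall i : 'I_m, (i < k)%N -> z 0 i = 0.
Proof.
split=> [zk i ik|zk].
  have /rowP/(_ (Ordinal ik)) := zk; rewrite !mxE (bigD1 i)//= big1 => [|j ji].
    by rewrite mxE eqxx ik mulr1 addr0.
  by rewrite mxE /= (_ : (j == i :> nat) = false) ?mulr0//; exact/negbTE.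
apply/rowP => j; rewrite !mxE big1// => i _; rewrite mxE.
have [ik|ik] := ltnP i k; first by rewrite zk// mul0r.
by rewrite andbF mulr0.
Qed.

(** The Jacobian D of B at a has rank k, so D = E pi R with E and R invertible
    and pi the projection on the first k coordinates.  The map Phi with first k
    coordinates B R^-1 and remaining coordinates those of x E has derivative E
    at a, hence is a chart near a, and B vanishes exactly where the first k
    coordinates of Phi do. *)
Theorem submersion_slice m k (U : set 'rV[R]_m) (B : 'rV[R]_m -> 'rV[R]_k) a :
  open U -> U a -> smooth_on U B -> (forall w, exists v, 'D_v B a = w) ->
  (k <= m)%N /\
  exists (W : set 'rV[R]_m) (Phi Psi : 'rV[R]_m -> 'rV[R]_m),
    [/\ open_nbhs a W /\ W `<=` U, smooth_on W Phi,
    open (Phi @` W) /\ smooth_on (Phi @` W) Psi,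
    forall x, W x -> Psi (Phi x) = x &
    forall x, W x ->
      (B x = 0 <-> forall i : 'I_m, (i < k)%N -> Phi x ord0 i = 0)].
Proof.
move=> oU Ua sB surB; have dB := smooth_on_differentiable sB Ua.
set D := jacobian B a.
have DE v : 'D_v B a = v *m D by exact: deriveEjacobian.
have [lift liftE] := choice surB.
have rD : \rank D = k.
  apply/eqP/row_fullP; exists (\matrix_j lift (delta_mx 0 j)).
  by apply/row_matrixP => j; rewrite row_mul rowK row1 -DE liftE.
have km : (k <= m)%N by rewrite -rD rank_leq_row.
split=> //.
pose E := col_ebase D; pose F := invmx (row_ebase D).
pose pi : 'M[R]_(m, k) := pid_mx k; pose pi' : 'M[R]_(k, m) := pid_mx k.
have pi'pi : pi' *m pi = 1%:M by rewrite /pi /pi' pid_mx_id// pid_mx_1.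
have DF : D *m F = E *m pi.
  have := mulmx_ebase D; rewrite rD => {1}<-.
  by rewrite mulmxK// row_ebase_unit.
(* x E with its first k coordinates replaced by those of B x R^-1 *)
pose Phi x := x *m (E - E *m pi *m pi') + B x *m (F *m pi').
have Phi_pi x : Phi x *m pi = B x *m F.
  rewrite /Phi mulmxDl -!mulmxA mulmxBl -!mulmxA pi'pi !mulmx1 subrr.
  by rewrite mulmx0 add0r.
have sPhi : smooth_on U Phi.
  move=> j; apply: Ck_onD => //; last exact: Ck_on_mulmxr.
  exact/smooth_on_rV_linear/linear_mulmxr.
have dPhi v : 'D_v Phi a = v *m E.
  have dl M : differentiable (fun x : 'rV[R]_m => x *m (M : 'M[R]_m)) a.
    have [L ->] := linear_bundle (linear_mulmxr M).
    by apply: linear_differentiable; exact: rV_linear_continuous.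
  have dr : differentiable (fun x => B x *m (F *m pi')) a.
    apply: (@smooth_on_differentiable _ _ _ U) => // j.
    exact: Ck_on_mulmxr.
  rewrite deriveD; [|exact: diff_derivable (dl _)|exact: diff_derivable dr].
  rewrite !(derive_rV_linear_comp _ (@linear_mulmxr _ _ _))// derive_id DE.
  rewrite -!mulmxA (mulmxA D) DF.
  by rewrite -mulmxDr -mulmxA subrK.
have [W [Psi [oW WU oI sPsi PhiK]]] :=
  inverse_function oU Ua sPhi (col_ebase_unit D) dPhi.
exists W, Phi, Psi; split=> //; first by move=> j; exact: Ck_on_sub (sPhi j).
move=> x Wx; rewrite -mul_pid_mx_eq0 -/pi Phi_pi; split=> [->|].
  by rewrite mul0mx.
have uF : F \in unitmx by rewrite unitmx_inv row_ebase_unit.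
by move=> BF; rewrite -(mulmxK uF (B x)) BF mul0mx.
Qed.

End submersion.

Section implicit.
Context {R : realType}.

Lemma smooth_on_row_mx (V : normedModType R) d m (A : set V)
    (f : V -> 'rV[R]_d) (g : V -> 'rV[R]_m) : open A ->
  smooth_on A f -> smooth_on A g -> smooth_on A (fun x => row_mx (f x) (g x)).
Proof.
move=> oA sf sg k; apply: Ck_on_row => // j; case: (splitP j) => i ji.
  have -> : (fun x => row_mx (f x) (g x) 0 j) = fun x => f x 0 i.
    apply/funext => x; rewrite (_ : j = lshift m i) ?row_mxEl//.
    exact: val_inj.
  exact: Ck_on_coord.
have -> : (fun x => row_mx (f x) (g x) 0 j) = fun x => g x 0 i.
  apply/funext => x; rewrite (_ : j = rshift d i) ?row_mxEr//.
  exact: val_inj.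
exact: Ck_on_coord.
Qed.

Lemma derive_row_mx (V : normedModType R) d m
    (f : V -> 'rV[R]_d) (g : V -> 'rV[R]_m) x v :
  differentiable (fun x => row_mx (f x) (g x)) x ->
  differentiable f x -> differentiable g x ->
  'D_v (fun x => row_mx (f x) (g x)) x = row_mx ('D_v f x) ('D_v g x).
Proof.
move=> dfg df dg; apply/rowP => j; rewrite derive_coord//.
case: (splitP j) => i ji.
  have E : j = lshift m i by exact: val_inj.
  rewrite E row_mxEl derive_coord//; congr ('D_v _ x).
  by apply/funext => y; rewrite row_mxEl.
have E : j = rshift d i by exact: val_inj.
rewrite E row_mxEr derive_coord//; congr ('D_v _ x).
by apply/funext => y; rewrite row_mxEr.
Qed.

Lemma linear_row_mx0l d m :
  linear (fun p : 'rV[R]_m => row_mx (0 : 'rV[R]_d) p).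
Proof. by move=> c u v; rewrite scale_row_mx add_row_mx scaler0 addr0. Qed.

Lemma linear_rsubmx d m : linear (fun w : 'rV[R]_(d + m) => rsubmx w).
Proof. by move=> c u v; rewrite linearP. Qed.

Lemma linear_lsubmx d m : linear (fun w : 'rV[R]_(d + m) => lsubmx w).
Proof. by move=> c u v; rewrite linearP. Qed.

(** Apply the inverse function theorem to Phi (x, p) = (H (x, p), p); the
    solution is zeta p = first component of Phi^-1 (0, p).  The neighbourhood
    Om1 serves for existence and uniqueness at once, and the last clause is the
    implicit differentiation formula in the form that needs no inverse. *)
Theorem implicit_function d m (Om : set 'rV[R]_(d + m))
    (H : 'rV[R]_(d + m) -> 'rV[R]_d) (x0 : 'rV[R]_d) (p0 : 'rV[R]_m) :
  let w0 := row_mx x0 p0 in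
  open Om -> Om w0 -> smooth_on Om H -> H w0 = 0 ->
  (forall y, exists v : 'rV[R]_d, 'D_(row_mx v 0) H w0 = y) ->
  exists (Om1 : set 'rV[R]_(d + m)) (Q : set 'rV[R]_m)
    (zeta : 'rV[R]_m -> 'rV[R]_d),
    [/\ open_nbhs w0 Om1 /\ Om1 `<=` Om, open_nbhs p0 Q /\ smooth_on Q zeta,
      forall p, Q p -> Om1 (row_mx (zeta p) p) /\ H (row_mx (zeta p) p) = 0,
      forall x p, Om1 (row_mx x p) -> H (row_mx x p) = 0 ->
        Q p /\ x = zeta p &
      forall v q, 'D_(row_mx v q) H w0 = 0 -> 'D_q zeta p0 = v].
Proof.
move=> w0 oOm Om0 sH H0 surH.
have dH := smooth_on_differentiable sH Om0.
pose Phi w := row_mx (H w) (rsubmx w : 'rV[R]_m).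
have sr (A : set 'rV[R]_(d + m)) :
    smooth_on A (fun w : 'rV[R]_(d + m) => rsubmx w : 'rV[R]_m).
  exact/smooth_on_rV_linear/linear_rsubmx.
have sPhi : smooth_on Om Phi by exact: smooth_on_row_mx.
have dPhi := smooth_on_differentiable sPhi Om0.
have DPhi u : 'D_u Phi w0 = row_mx ('D_u H w0) (rsubmx u).
  have dr : differentiable (fun w : 'rV[R]_(d + m) => rsubmx w : 'rV[R]_m) w0.
    exact: smooth_on_differentiable (sr _) Om0.
  rewrite derive_row_mx//.
  by rewrite (derive_rV_linear _ _ (@linear_rsubmx d m)).
pose E := jacobian Phi w0.
have PhiE u : 'D_u Phi w0 = u *m E by exact: deriveEjacobian.
have uE : E \in unitmx.
  rewrite -row_full_unit.
  have sur y : exists u, 'D_u Phi w0 = y.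
    have [v vE] := surH (lsubmx y - 'D_(row_mx 0 (rsubmx y)) H w0).
    exists (row_mx v 0 + row_mx 0 (rsubmx y)).
    rewrite DPhi [X in row_mx X _]deriveE// linearD -!deriveE// vE subrK.
    by rewrite add_row_mx addr0 add0r row_mxKr hsubmxK.
  have [lift liftE] := choice sur.
  apply/row_fullP; exists (\matrix_j lift (delta_mx 0 j)).
  by apply/row_matrixP => j; rewrite row_mul rowK row1 -PhiE liftE.
have [W [Psi [[oW Ww0] WOm oI sPsi PhiK]]] :=
  inverse_function oOm Om0 sPhi uE PhiE.
pose iota (p : 'rV[R]_m) := row_mx (0 : 'rV[R]_d) p.
have ciota : continuous iota.
  exact/rV_linear_continuous_fun/linear_row_mx0l.
have Phi0 : Phi w0 = iota p0 by rewrite /Phi H0 /w0 row_mxKr.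
pose Q := iota @^-1` (Phi @` W).
pose zeta p := lsubmx (Psi (iota p)) : 'rV[R]_d.
have oQ : open Q by apply: open_comp => // x _; exact: ciota.
have Q0 : Q p0 by exists w0.
have sPi : smooth_on Q (Psi \o iota).
  apply: (@smooth_on_comp _ _ _ _ Q (Phi @` W)) => //.
  exact/smooth_on_rV_linear/linear_row_mx0l.
have szeta : smooth_on Q zeta.
  apply: (@smooth_on_comp _ _ _ _ Q setT (Psi \o iota)
    (fun w : 'rV[R]_(d + m) => lsubmx w : 'rV[R]_d)) => //; first exact: openT.
  exact/smooth_on_rV_linear/linear_lsubmx.
have QE p : Q p -> Psi (iota p) = row_mx (zeta p) p /\ W (Psi (iota p)) /\
    H (Psi (iota p)) = 0.
  move=> [w Ww Phiw]; have PE : Psi (iota p) = w by rewrite -Phiw PhiK.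
  have [Hw rw] : H w = 0 /\ rsubmx w = p.
    by apply: eq_row_mx; rewrite -/(iota p) -Phiw.
  by rewrite /zeta PE; split=> //; rewrite -rw hsubmxK.
exists W, Q, zeta; split=> //.
- by move=> p /QE[<- []].
- move=> x p Wxp Hxp; have PE : Phi (row_mx x p) = iota p.
    by rewrite /Phi Hxp row_mxKr.
  split; first by exists (row_mx x p).
  by rewrite /zeta -PE PhiK// row_mxKl.
- move=> v q Hvq.
  have dPsi : differentiable Psi (Phi w0).
    by apply: smooth_on_differentiable sPsi _; exists w0.
  (* differentiate Psi o Phi = id *)
  have DPsi u : 'D_('D_u Phi w0) Psi (Phi w0) = u.
    rewrite -derive_comp// -[RHS](derive_id w0 u); apply: near_eq_derive.
    by apply: filterS (open_near oW Ww0) => w Ww /=; rewrite PhiK.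
  have diota : differentiable iota p0.
    by apply: (@smooth_on_differentiable _ _ _ setT) => //;
      exact/smooth_on_rV_linear/linear_row_mx0l.
  have Diota : 'D_q iota p0 = iota q.
    exact: derive_rV_linear (@linear_row_mx0l d m).
  have dPi := smooth_on_differentiable sPi Q0.
  have -> : 'D_q zeta p0 = lsubmx ('D_q (Psi \o iota) p0).
    exact: (derive_rV_linear_comp _ (@linear_lsubmx d m) dPi).
  rewrite (@derive_comp _ _ _ _ iota Psi)//; last by rewrite -Phi0.
  rewrite Diota -Phi0 (_ : iota q = 'D_(row_mx v q) Phi w0) ?DPsi ?row_mxKl//.
  by rewrite DPhi Hvq row_mxKr.
Qed.

End implicit.

(** * Lie derivatives in charts *)

Lemma open_prod (T U : topologicalType) (A : set T) (B : set U) :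
  open A -> open B -> open (A `*` B).
Proof.
move=> oA oB; rewrite openE => -[x y] [/= Ax By].
by exists (A, B) => //; split; apply: open_nbhs_nbhs.
Qed.

Section partial.
Context {R : realType}.

Lemma differentiable_partial (V1 V2 W : normedModType R) (f : V1 * V2 -> W)
    x p : differentiable f (x, p) -> differentiable (fun y => f (y, p)) x.
Proof.
move=> df; apply: (@differentiable_comp _ _ _ _ (fun y : V1 => (y, p)) f)=> //.
Qed.

Lemma derive_partial (V1 V2 W : normedModType R) (f : V1 * V2 -> W) x p v :
  differentiable f (x, p) ->
  'D_v (fun y => f (y, p)) x = 'D_(v, 0) f (x, p).
Proof.
move=> df.
have dpair : is_diff x (fun y : V1 => (y, p)) (fun v => (v, (0 : V1 -> V2) v)).
  exact: (is_diff_pair (is_diff_id x) (is_diff_cst p x)).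
have dp : differentiable (fun y : V1 => (y, p)) x by case: dpair.
rewrite (@derive_comp _ _ _ _ (fun y : V1 => (y, p)) f)//.
by congr ('D_ _ f (x, p)); rewrite deriveE// diff_val.
Qed.

End partial.

Section lie.
Context {R : realType} {M : surface R} {m : nat}.
Variables (P : set 'rV[R]_m) (X : chart M -> M -> 'rV[R]_m -> 'rV[R]_2).
Hypotheses (oP : open P) (sX : smooth_vector_field_family P X).

Let image i := chart_coord i @` @chart_dom R M i.

Lemma smooth_family_differentiable (f : M -> 'rV[R]_m -> R) i x p :
  smooth_function_family P f -> image i x -> P p ->
  differentiable
    (fun a : 'rV[R]_2 * 'rV[R]_m => f (chart_param i a.1) a.2) (x, p).
Proof. by move=> sf ix Pp; apply: smooth_on_differentiable (sf i) _; split. Qed.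

(** The Lie derivative is computed in a chart that varies with the point; the
    transformation law of the components of X and the chain rule for the
    transition map show that every chart around the point gives the same
    value. *)
Lemma lie_derivative_chart (f : M -> 'rV[R]_m -> R) i z p :
  smooth_function_family P f -> chart_dom i z -> P p ->
  lie_derivative X f z p =
  'D_(X i z p) (fun x : 'rV[R]_2 => f (chart_param i x) p) (chart_coord i z).
Proof.
move=> sf iz Pp; rewrite /lie_derivative; set j := chart_at z.
have jz : chart_dom j z by exact: dom_chart_at.
pose tau : 'rV[R]_2 -> 'rV[R]_2 := chart_coord j \o chart_param i.
set x := chart_coord i z.
have taux : tau x = chart_coord j z by rewrite /tau /= chart_coordK.
have dtau : differentiable tau x.
  by apply: smooth_on_differentiable (transition_smooth i j) _; exists z.
have ix : image i x by exists z.
have dfj : differentiable (fun y => f (chart_param j y) p) (tau x).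
  apply: (@differentiable_partial _ _ _ _
    (fun a : 'rV[R]_2 * 'rV[R]_m => f (chart_param j a.1) a.2)).
  by apply: smooth_family_differentiable => //; rewrite taux; exists z.
have -> : X j z p = 'D_(X i z p) tau x.
  by rewrite (sX.1 i j z p)// deriveE.
rewrite -taux -derive_comp//; apply: near_eq_derive.
have near_j : \forall y \near x, chart_dom j (chart_param i y).
  have /(_ (chart_dom j)) := chart_param_continuous ix.
  rewrite chart_coordK//; apply.
  by apply: open_nbhs_nbhs; split=> //; exact: chart_dom_open.
by apply: filterS near_j => y jy /=; rewrite /tau /= chart_coordK.
Qed.

(** In a fixed chart the Lie derivative is the sum of X_j times the j-th partial
    derivative. *)
Lemma smooth_lie_derivative (f : M -> 'rV[R]_m -> R) :
  smooth_function_family P f -> smooth_function_family P (lie_derivative X f).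
Proof.
move=> sf i k; set A := image i `*` P.
pose F a := f (chart_param i a.1) a.2.
have oA : open A by apply: open_prod => //; exact: chart_image_open.
pose Y (a : 'rV[R]_2 * 'rV[R]_m) := X i (chart_param i a.1) a.2.
have CY : Ck_on k A Y by exact: (sX.2 i).
have C : Ck_on k A (fun a => \sum_j Y a 0 j * 'D_(delta_mx 0 j, 0) F a).
  apply: Ck_on_sum => // j _; apply: Ck_onM => //; first exact: Ck_on_coord.
  by apply: smooth_on_derive; exact: sf.
apply: (Ck_on_ext oA _ C) => -[x p] [/= [z iz <-] Pp].
rewrite chart_coordK// (lie_derivative_chart sf iz Pp).
have ix : image i (chart_coord i z) by exists z.
have dF := smooth_family_differentiable sf ix Pp.
rewrite derive_rV_sum; last exact: differentiable_partial dF.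
apply: eq_bigr => j _; rewrite /Y /= chart_coordK//.
by congr (_ * _); rewrite (derive_partial _ dF).
Qed.

Lemma smooth_iter_lie (h : M -> 'rV[R]_m -> R) k :
  smooth_function_family P h -> smooth_function_family P (iter_lie X h k).
Proof. by move=> sh; elim: k => // k IH; exact: smooth_lie_derivative. Qed.

End lie.

(** * Equations of the projected stratum *)

(** Turns the rank condition of a transverse contact into surjectivity. *)
Lemma rank_surjective (R : realType) d m k
    (f : {linear ('rV[R]_d * 'rV[R]_m)%type -> 'rV[R]_k}) :
  (\dim (limg (linfun f)) = k)%N -> forall w, exists v, f v = w.
Proof.
move=> rk w.
have full : limg (linfun f) = fullv.
  by apply/eqP; rewrite eqEdim subvf rk dimvf /dim /= mul1n leqnn.
have : w \in limg (linfun f) by rewrite full memvf.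
by move=> /memv_imgP[v _ ->]; exists v; rewrite lfunE.
Qed.

Section contact.
Context {R : realType} {M : surface R} {m : nat}.
Variables (P : set 'rV[R]_m) (X : chart M -> M -> 'rV[R]_m -> 'rV[R]_2)
  (h : M -> 'rV[R]_m -> R) (nu : nat) (z0 : M) (p0 : 'rV[R]_m).
Hypotheses (oP : open P) (sX : smooth_vector_field_family P X)
  (sh : smooth_function_family P h) (nu2 : (2 <= nu)%N)
  (contact0 : transverse_contact P X h nu z0 p0).

Let i := chart_at z0.
Let x0 := chart_coord i z0.
Let A := (chart_coord i @` chart_dom i) `*` P.
Let F k (a : 'rV[R]_2 * 'rV[R]_m) := iter_lie X h k (chart_param i a.1) a.2.

Let iz0 : chart_dom i z0. Proof. exact: dom_chart_at. Qed.
Let Pp0 : P p0. Proof. by case: contact0. Qed.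
Let A0 : A (x0, p0). Proof. by split=> //; exists z0. Qed.
Let oA : open A.
Proof. by apply: open_prod => //; exact: chart_image_open. Qed.
Let sF k : smooth_on A (F k).
Proof. exact: (smooth_iter_lie oP sX k sh i). Qed.
Let dF k : differentiable (F k) (x0, p0).
Proof. exact: smooth_on_differentiable (sF k) A0. Qed.

Let F0 k : F k (x0, p0) = iter_lie X h k z0 p0.
Proof. by rewrite /F /= chart_coordK. Qed.

Let F0_eq0 k : (k < nu)%N -> F k (x0, p0) = 0.
Proof.
move=> kn; rewrite F0; have [_ [/rowP/(_ (Ordinal kn)) + _ _ _ _]] := contact0.
by rewrite !mxE.
Qed.

(** The recursion between the jet functions: this is what ties the contact
    order to the derivatives in the direction of the field. *)
Let derive_field k : 'D_(X i z0 p0, 0) (F k) (x0, p0) = F k.+1 (x0, p0).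
Proof.
rewrite F0 /= (lie_derivative_chart sX (smooth_iter_lie oP sX k sh) iz0 Pp0).
by rewrite (@derive_partial _ _ _ _ (F k)).
Qed.

Let jet_surjective (t : nat -> R) :
  exists u, forall k, (k < nu)%N -> 'D_u (F k) (x0, p0) = t k.
Proof.
pose J (a : 'rV[R]_2 * 'rV[R]_m) := jet X h nu (chart_param i a.1) a.2.
have dJ : differentiable J (x0, p0).
  apply: (@smooth_on_differentiable _ _ _ A) => // k; apply: Ck_on_row => // j.
  rewrite (_ : (fun _ => _) = F j); first exact: sF.
  by apply/funext => a; rewrite mxE.
have [_ [_ _ rk _ _]] := contact0.
have [u uE] := rank_surjective rk (\row_(k < nu) t k).
exists u => k kn; have : 'D_u J (x0, p0) = \row_(k < nu) t k by rewrite deriveE.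
move=> /rowP/(_ (Ordinal kn)); rewrite derive_coord// mxE /= => <-.
by congr ('D_u _ _); apply/funext => a; rewrite mxE.
Qed.

(** Row vectors of length 2 + m stand for pairs (x, p), so that the inverse
    function theorem, stated for row vectors, applies. *)
Let pair_of (w : 'rV[R]_(2 + m)) : 'rV[R]_2 * 'rV[R]_m := (lsubmx w, rsubmx w).
Let pair_of_linear : linear pair_of.
Proof. by move=> c u v; rewrite /pair_of !linearP. Qed.
Let Om := pair_of @^-1` A.
Let oOm : open Om.
Proof.
apply: open_comp => // w _; exact: rV_linear_continuous_fun pair_of_linear w.
Qed.
Let w0 := row_mx x0 p0.
Let pair_of_row x p : pair_of (row_mx x p) = (x, p).
Proof. by rewrite /pair_of row_mxKl row_mxKr. Qed.
Let Om0 : Om w0. Proof. by rewrite /Om /= /w0 pair_of_row. Qed.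
Let sG k : smooth_on Om (F k \o pair_of).
Proof.
move=> j; have [L LE] := linear_bundle pair_of_linear.
have -> : F k \o pair_of = fun w => F k (L w + 0).
  by apply/funext => w; rewrite addr0 -LE.
apply: (Ck_on_affine_comp oOm _ _ (sF k j)); first exact: rV_linear_continuous.
by move=> w; rewrite addr0 -LE.
Qed.
Let dG k v q :
  'D_(row_mx v q) (F k \o pair_of) w0 = 'D_(v, q) (F k) (x0, p0).
Proof.
have dp : differentiable pair_of w0.
  apply: (@smooth_on_differentiable _ _ _ setT) => //.
  exact: smooth_on_rV_linear pair_of_linear.
have dFw : differentiable (F k) (pair_of w0) by rewrite /w0 pair_of_row.
by rewrite derive_comp// (derive_rV_linear _ _ pair_of_linear) !pair_of_row.
Qed.

(** The two equations solved for the point of the surface: the first and the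
    last component of the jet. *)
Let ends (j : 'I_2) := if (j : nat) == 0%N then 0%N else nu.-1.
Let H (w : 'rV[R]_(2 + m)) : 'rV[R]_2 :=
  \row_j (F (ends j) \o pair_of) w.
Let sH : smooth_on Om H.
Proof.
move=> k; apply: Ck_on_row => // j.
rewrite (_ : (fun _ => _) = F (ends j) \o pair_of); first exact: sG.
by apply/funext => w; rewrite mxE.
Qed.
Let dH v q :
  'D_(row_mx v q) H w0 = \row_j 'D_(v, q) (F (ends j)) (x0, p0).
Proof.
apply/rowP => j; rewrite derive_coord; last first.
  exact: smooth_on_differentiable sH Om0.
have -> : (fun w => H w 0 j) = F (ends j) \o pair_of.
  by apply/funext => w; rewrite mxE.
by rewrite dG [RHS]mxE.
Qed.

(** With alpha = D_x F_0 and beta = D_x F_(nu-1), the field direction xi has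
    alpha(xi) = 0 and beta(xi) <> 0, and some v0 has alpha(v0) <> 0: the system
    for a xi + b v0 is triangular.  Here alpha(xi) = F_1 = 0 because nu >= 2. *)
Let surH (y : 'rV[R]_2) : exists v, 'D_(row_mx v 0) H w0 = y.
Proof.
have [_ [_ Fnu _ _ [v0 v0E]]] := contact0.
pose xi := X i z0 p0.
have xi0 : 'D_(xi, 0) (F 0%N) (x0, p0) = 0 by rewrite derive_field F0_eq0.
have xi1 : 'D_(xi, 0) (F nu.-1) (x0, p0) != 0.
  by rewrite derive_field prednK ?F0//; lia.
have v00 : 'D_(v0, 0) (F 0%N) (x0, p0) != 0.
  rewrite -(@derive_partial _ _ _ _ (F 0%N))// deriveE//.
  exact: differentiable_partial (dF 0).
set c := 'D_(xi, 0) (F nu.-1) _ in xi1; set d := 'D_(v0, 0) (F 0%N) _ in v00.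
pose b := y 0 0 / d.
pose a := (y 0 (lift ord0 ord0) - b * 'D_(v0, 0) (F nu.-1) (x0, p0)) / c.
exists (a *: xi + b *: v0); rewrite dH.
have DE k : 'D_(a *: xi + b *: v0, 0) (F k) (x0, p0) =
    a * 'D_(xi, 0) (F k) (x0, p0) + b * 'D_(v0, 0) (F k) (x0, p0).
  rewrite (_ : (_, 0) = a *: (xi, 0) + b *: (v0, 0)).
    by rewrite !deriveE// linearP linearZ.
  by congr (_, _); rewrite /= !scaler0 addr0.
apply/rowP => j; rewrite mxE DE.
case: (splitP (j : 'I_(1 + 1))) => k jk.
  have -> : j = 0 by apply: val_inj; rewrite /= jk; case: k {jk} => -[].
  by rewrite /ends /= xi0 mulr0 add0r -/d divfK.
have -> : j = lift ord0 ord0 by apply: val_inj; rewrite /= jk ord1.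
by rewrite /ends /= -/c divfK// subrK.
Qed.

(** The germ of the projected stratum is cut out by nu - 2 functions that are
    independent at p0; g k is F_(k+1) along the solution zeta of the two end
    equations.  Independence: a prescribed value of the derivatives is reached
    by some (v, q) killing the two end equations, and then v is forced to be
    the derivative of zeta along q. *)
Lemma stratum_equations :
  exists (O0 : set (M * 'rV[R]_m)) (Q : set 'rV[R]_m)
    (g : nat -> 'rV[R]_m -> R),
    [/\ open_nbhs (z0, p0) O0, open_nbhs p0 Q /\ Q `<=` P,
      forall k, smooth_on Q (g k),
      forall t : nat -> R, exists q,
        forall k, (k < nu - 2)%N -> 'D_q (g k) p0 = t k &
      forall O, open_nbhs (z0, p0) O -> O `<=` O0 ->
        \forall p \near p0, projected_stratum P X h nu O p <->
          forall k, (k < nu - 2)%N -> g k p = 0].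
Proof.
have H0 : H w0 = 0.
  apply/rowP => j; rewrite !mxE /= /w0 pair_of_row F0_eq0// /ends.
  by case: ifP => _; lia.
have [Om1 [Q [zeta [[oOm1 Om1Om] [[oQ Q0] szeta] QE uniq Dzeta]]]] :=
  implicit_function oOm Om0 sH H0 surH.
have Om10 : Om1 w0 by case: oOm1.
have HF x p k : H (row_mx x p) = 0 -> k = 0%N \/ k = nu.-1 -> F k (x, p) = 0.
  move=> Hxp [->|->].
    by have /rowP/(_ 0) := Hxp; rewrite !mxE /= pair_of_row.
  by have /rowP/(_ (lift ord0 ord0)) := Hxp; rewrite !mxE /= pair_of_row.
have zeta0 : zeta p0 = x0 by have [] := uniq _ _ Om10 H0.
have QA p : Q p -> A (zeta p, p).
  by move=> /QE[/Om1Om + _]; rewrite /Om /= pair_of_row.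
pose g k p := F k.+1 (zeta p, p).
have gE k : g k = (F k.+1 \o pair_of) \o (fun p => row_mx (zeta p) p).
  by apply/funext => p; rewrite /= pair_of_row.
have srow : smooth_on Q (fun p => row_mx (zeta p) p).
  by apply: smooth_on_row_mx => //; exact: smooth_on_rV_linear.
have sg k : smooth_on Q (g k).
  rewrite gE => j; apply: (Ck_on_comp oQ _ (srow j) (sG k.+1 j)).
  by move=> p /QE[/Om1Om].
have czeta : {for p0, continuous zeta} by exact: smooth_on_continuous szeta Q0.
have near_z0 : nbhs (z0, p0)
    [set a | chart_dom i a.1 /\ Om1 (row_mx (chart_coord i a.1) a.2)].
  have near_x0 : nbhs (x0, p0) [set b | Om1 (row_mx b.1 b.2)].
    have crow : {for (x0, p0), continuous (fun b => row_mx b.1 b.2)}.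
      have -> : (fun b : 'rV[R]_2 * 'rV[R]_m => row_mx b.1 b.2) =
          (fun b => row_mx b.1 0 + row_mx 0 b.2).
        by apply/funext => b; rewrite add_row_mx addr0 add0r.
      apply: cvgD.
        apply: (@continuous_comp _ _ _ fst (fun x : 'rV[R]_2 => row_mx x 0)).
          exact: cvg_fst.
        apply: rV_linear_continuous_fun => c u v.
        by rewrite scale_row_mx add_row_mx scaler0 addr0.
      apply: (@continuous_comp _ _ _ snd (fun p : 'rV[R]_m => row_mx 0 p)).
        exact: cvg_snd.
      exact/rV_linear_continuous_fun/linear_row_mx0l.
    exact: crow (open_near oOm1.1 Om10).
  have [[B1 B2] /= [n1 n2] sub] := near_x0.
  exists (chart_dom i `&` chart_coord i @^-1` B1, B2) => /=.
    split=> //; apply: filterI; last exact: chart_coord_continuous n1.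
    by apply: open_nbhs_nbhs; split=> //; exact: chart_dom_open.
  by move=> [z p] [/= [iz B1z] B2p]; split=> //; exact: (sub (_, _)).
have [N0 [oN0 N00] sN0] : exists2 N0, open_nbhs (z0, p0) N0 &
    N0 `<=` [set a | chart_dom i a.1 /\ Om1 (row_mx (chart_coord i a.1) a.2)].
  by move: near_z0; rewrite nbhsE.
exists N0, Q, g; split=> //.
- by split=> // p /QA[].
- move=> t.
  have [u uE] := jet_surjective
    (fun k => if (0 < k < nu.-1)%N then t k.-1 else 0).
  case: u uE => v q uE; exists q => k kn.
  have Hvq : 'D_(row_mx v q) H w0 = 0.
    rewrite dH; apply/rowP => j; rewrite !mxE uE /ends; last first.
      by case: ifP => _; lia.
    by case: ((j : nat) == 0%N); rewrite /= ?ltnn ?andbF.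
  have dzeta := smooth_on_differentiable szeta Q0.
  have drow := smooth_on_differentiable srow Q0.
  rewrite gE derive_comp//; last first.
    by rewrite zeta0; exact: smooth_on_differentiable (sG k.+1) Om0.
  rewrite derive_row_mx// derive_id (Dzeta _ _ Hvq) zeta0 dG uE; last by lia.
  by rewrite /= (_ : (k.+1 < nu.-1)%N)//; lia.
- move=> N [oN Nz0] NN0.
  have near_Q : \forall p \near p0, Q p by exact: open_near.
  have near_N : \forall p \near p0, N (chart_param i (zeta p), p).
    have [[B1 B2] /= [n1 n2] sub] : nbhs (z0, p0) N by exact: open_nbhs_nbhs.
    have near_B1 : \forall p \near p0, B1 (chart_param i (zeta p)).
      have ix0 : (chart_coord i @` chart_dom i) x0 by exists z0.
      have cparam := chart_param_continuous ix0.
      have n0 : nbhs (chart_param i x0) B1 by rewrite chart_coordK.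
      have n0' := cparam _ n0; rewrite -zeta0 in n0'.
      exact: czeta _ n0'.
    apply: filterS2 near_B1 n2 => p B1p B2p.
    exact: (sub (chart_param i (zeta p), p)).
  near=> p.
  have Qp : Q p by near: p.
  have Np : N (chart_param i (zeta p), p) by near: p.
  have [[z iz zx] Pp] := QA p Qp.
  have [_ Hp] := QE p Qp.
  split=> [[[z' p'] [[/= Pp' jz] Nz] /= pp'] k kn|gp].
    rewrite {}pp' in Pp' jz Nz.
    have [/= iz' Om1z] := sN0 _ (NN0 _ Nz).
    have Fz j : (j < nu)%N -> F j (chart_coord i z', p) = 0.
      move=> jn; have /rowP/(_ (Ordinal jn)) := jz.
      by rewrite !mxE /F /= chart_coordK.
    have Hz : H (row_mx (chart_coord i z') p) = 0.
      apply/rowP => j; rewrite !mxE /= pair_of_row Fz// /ends.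
      by case: ifP => _; lia.
    rewrite /g -(uniq _ _ Om1z Hz).2.
    by apply: Fz; lia.
  exists (chart_param i (zeta p), p) => //; split=> //; split=> //=.
  apply/rowP => -[k kn]; rewrite !mxE /=.
  change (F k (zeta p, p) = 0).
  have [k0|k0] := eqVneq k 0%N; first by apply: HF => //; left.
  have [k1|k1] := eqVneq k nu.-1; first by apply: HF => //; right.
  by have := gp k.-1; rewrite /g prednK; [apply; lia|lia].
Unshelve. all: by end_near. Qed.

End contact.

(** * The neutral grazing locus *)

Section taylor.
Context {R : realType} {m : nat}.
Implicit Types (N : set (R * 'rV[R]_m)) (F : R * 'rV[R]_m -> R).

(** Iterated partial derivative in the first variable, as a function of both
    variables so that its smoothness is that of F. *)
Definition first_derive k F :=
  iter k (fun (f : R * 'rV[R]_m -> R) a => 'D_((1 : R), (0 : 'rV[R]_m)) f a) F.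

Lemma smooth_first_derive N F k : smooth_on N F ->
  smooth_on N (first_derive k F).
Proof. by move=> sF; elim: k => //= k IH; exact: smooth_on_derive. Qed.

(** Applied to a slice of S: its derivatives at 0 only see values near 0, where
    S coincides with its smooth extension. *)
Lemma derive1n_slice N F (s : R -> R) p k q : open N -> smooth_on N F ->
  (forall q, N (q, p) -> s q = F (q, p)) -> N (q, p) ->
  derive1n k s q = first_derive k F (q, p).
Proof.
move=> oN sF sE; elim: k q => [|k IH] q Nq; first by rewrite derive1n0 sE.
have dk := smooth_on_differentiable (smooth_first_derive k sF) Nq.
rewrite derive1nS derive1E /= -(derive_partial _ dk).
apply: near_eq_derive.
have near_N : \forall q' \near q, N (q', p).
  have [[B1 B2] /= [n1 n2] sub] : nbhs (q, p) N by exact: open_nbhs_nbhs.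
  apply: filterS n1 => q' B1q'; apply: (sub (q', p)).
  by split=> //; exact: nbhs_singleton n2.
by apply: filterS near_N => q' Nq' /=; rewrite IH.
Qed.

Let zero_section (p : 'rV[R]_m) : R * 'rV[R]_m := (0, p).
Let zero_section_linear : linear zero_section.
Proof.
by move=> c u v; rewrite /zero_section; congr pair; rewrite /= scaler0 addr0.
Qed.

Lemma open_zero_section N : open N -> open [set p | N (0, p)].
Proof.
move=> oN; have -> : [set p | N (0, p)] = zero_section @^-1` N by [].
by apply: open_comp => // p _; exact: rV_linear_continuous_fun zero_section_linear p.
Qed.

Lemma smooth_zero_section N F : open N -> smooth_on N F ->
  smooth_on [set p | N (0, p)] (fun p => F (0, p)).
Proof.
move=> oN sF k; have [L LE] := linear_bundle zero_section_linear.
have -> : (fun p => F (0, p)) = fun p => F (L p + 0).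
  by apply/funext => p; rewrite addr0 -LE.
apply: (Ck_on_affine_comp (open_zero_section oN) _ _ (sF k)).
  exact: rV_linear_continuous.
by move=> p; rewrite addr0 -LE.
Qed.

End taylor.

Lemma derive1_curve (R : realType) (V W : normedModType R) (g : R -> V)
    (f : V -> W) t : differentiable g t -> differentiable f (g t) ->
  derive1 (f \o g) t = 'D_(derive1 g t) f (g t).
Proof. by move=> dg df; rewrite !derive1E derive_comp. Qed.

(** Differentiating g = 0 along curves in G puts the tangent space of G in the
    kernel of dg.  Correcting a vector
    that realises given values of dg by a tangent vector realises given values
    of dc as well, so (c, g) is a submersion. *)
Lemma neutral_locus_submanifold (R : realType) m (P G Q : set 'rV[R]_m)
    (p0 : 'rV[R]_m) (r : nat) (g : nat -> 'rV[R]_m -> R)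
    (n : nat) (S : R -> 'rV[R]_m -> R) :
  open_nbhs p0 Q -> Q `<=` P -> (forall k, smooth_on Q (g k)) ->
  (forall t : nat -> R, exists q, forall k, (k < r)%N -> 'D_q (g k) p0 = t k) ->
  (\forall p \near p0, G p <-> forall k, (k < r)%N -> g k p = 0) ->
  smooth_near_in [set a : R * 'rV[R]_m | G a.2] (0, p0)
    (fun a => S a.1 a.2) ->
  differential_rank G (taylor_map n S) p0 n ->
  embedded_submanifold_germ (n + r) P (neutral_grazing_locus n G S) p0 /\
  (n + r <= m)%N.
Proof.
move=> [oQ Q0] QP sg sur_g GE [N [F [[oN N0] sF FE]]] [T [L [TE LE rkL]]].
pose c k p := first_derive k F (0, p) / k`!%:R.
have taylorE p k : G p -> N (0, p) -> taylor_coef S k p = c k p.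
  move=> Gp Np; rewrite /taylor_coef /c; congr (_ / _).
  by apply: derive1n_slice oN sF _ Np => q Nq; exact: FE Nq Gp.
have [V [oV V0] VE] : exists2 V : set 'rV[R]_m, open_nbhs p0 V & V `<=`
    [set p | [/\ Q p, N (0, p) & G p <-> forall k, (k < r)%N -> g k p = 0]].
  have nQ : \forall p \near p0, Q p by exact: open_near.
  have nN : \forall p \near p0, N (0, p).
    exact: (open_near (open_zero_section oN) N0).
  have : nbhs p0 [set p | [/\ Q p, N (0, p) & G p <->
      forall k, (k < r)%N -> g k p = 0]].
    by apply: filterS3 nQ nN GE.
  by rewrite nbhsE.
have sc k : smooth_on V (c k).
  move=> j; apply: Ck_onM => //; last exact: Ck_on_cst.
  apply: (@Ck_on_sub _ _ _ _ _ [set p | N (0, p)]); first by move=> p /VE[].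
  exact: (smooth_zero_section oN (smooth_first_derive k sF)).
have sgV k : smooth_on V (g k).
  by move=> j; apply: Ck_on_sub (sg k j) => p /VE[].
pose b k := if (k < n)%N then c k else g (k - n)%N.
have sb k : smooth_on V (b k) by rewrite /b; case: ifP.
pose B p : 'rV[R]_(n + r) := \row_j b j p.
have sB : smooth_on V B.
  move=> k; apply: Ck_on_row => // j.
  rewrite (_ : (fun _ => _) = b j); first exact: sb.
  by apply/funext => p; rewrite mxE.
have DB v j : 'D_v B p0 0 j = 'D_v (b j) p0.
  rewrite derive_coord; last exact: smooth_on_differentiable sB V0.
  suff -> : (fun p => B p 0 j) = b j by [].
  by apply/funext => p; rewrite mxE.
pose C p : 'rV[R]_n := \row_j c j p.
have sC : smooth_on V C.
  move=> k; apply: Ck_on_row => // j.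
  rewrite (_ : (fun _ => _) = c j); first exact: sc.
  by apply/funext => p; rewrite mxE.
(* every value of dc is taken on a vector tangent to G, where dg vanishes *)
have curve (u : 'rV[R]_n) : exists2 v, forall j : 'I_n, 'D_v (c j) p0 = u 0 j &
    forall k, (k < r)%N -> 'D_v (g k) p0 = 0.
  have : u \in (L @: T)%VS.
    suff -> : (L @: T)%VS = fullv by rewrite memvf.
    by apply/eqP; rewrite eqEdim subvf rkL dimvf /dim /= mul1n leqnn.
  move=> /memv_imgP[v vT ->]; have [gam gamG gamv] := (TE v).1 vT.
  have := LE _ gamG; rewrite gamv.
  case: gamG => gam0 [D [[oD D0] sgam DG]].
  have dgam := smooth_on_differentiable sgam D0.
  have nV : \forall t \near 0, V (gam t) /\ G (gam t).
    have cg : {for 0, continuous gam} by exact: differentiable_continuous.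
    have nV0 : nbhs (gam 0) V by rewrite gam0; exact: open_nbhs_nbhs.
    apply: filterI; first exact: cg _ nV0.
    by apply: filterS (open_near oD D0) => t; exact: DG.
  have dE (W : normedModType R) (f : 'rV[R]_m -> W) (e : R -> W) :
      smooth_on V f -> (\forall t \near 0, e t = f (gam t)) ->
      derive1 e 0 = 'D_v f p0.
    move=> sf ef; rewrite -gam0 -gamv -derive1_curve//; last first.
      by rewrite gam0; exact: smooth_on_differentiable sf V0.
    by rewrite !derive1E; exact: near_eq_derive.
  move=> Lv; exists v => [j|k kr].
    rewrite -Lv (dE _ C)//; last first.
      apply: filterS nV => t [Vt Gt] /=; apply/rowP => j'; rewrite !mxE.
      by apply: taylorE => //; have [] := VE _ Vt.
    rewrite derive_coord; last exact: smooth_on_differentiable sC V0.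
    suff -> : (fun p => C p 0 j) = c j by [].
    by apply/funext => p; rewrite mxE.
  rewrite -(dE _ (g k) (fun=> 0))//; first by rewrite derive1E derive_cst.
  apply: filterS nV => t [Vt Gt]; have [_ _ GE'] := VE _ Vt.
  by rewrite (GE'.1 Gt).
have surB (w : 'rV[R]_(n + r)) : exists v, 'D_v B p0 = w.
  pose w' (j : nat) := oapp (fun j' : 'I_(n + r) => w 0 j') 0 (insub j).
  have w'E (j : 'I_(n + r)) : w' j = w 0 j by rewrite /w' valK.
  have [q qE] := sur_g (fun k => w' (n + k)%N).
  have [v vc vg] := curve (\row_j (w' j - 'D_q (c j) p0)).
  exists (q + v); apply/rowP => j; rewrite DB -w'E.
  have db := smooth_on_differentiable (sb j) V0.
  rewrite deriveE// linearD -!deriveE// /b.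
  case: ltnP => jn.
    by rewrite (vc (Ordinal jn)) mxE addrC subrK.
  have jr : (j - n < r)%N by rewrite ltn_subLR.
  by rewrite qE// vg// addr0 subnKC.
have [nm [W [Phi [Psi [[oW WV] sPhi [oI sPsi] PhiK PhiE]]]]] :=
  submersion_slice oV V0 sB surB.
split=> //; exists W => //; split=> //.
split; first by move=> p [_ /WV/VE[/QP]].
move=> p [_ Wp]; exists W, Phi, Psi; split=> //.
  by split; [split=> //; case: oW|move=> x /WV/VE[/QP]].
move=> x Wx; rewrite -PhiE//; have [Qx Nx Gx] := VE _ (WV _ Wx).
have BE : B x = 0 <-> (forall k, (k < n)%N -> c k x = 0) /\
    forall k, (k < r)%N -> g k x = 0.
  split=> [/rowP Bx|[cx gx]].
    split=> k kn.
      have kr : (k < n + r)%N by exact: ltn_addr.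
      by have := Bx (Ordinal kr); rewrite !mxE /b /= kn.
    have kr : (n + k < n + r)%N by rewrite ltn_add2l.
    by have := Bx (Ordinal kr); rewrite !mxE /b /= ltnNge leq_addr /= addKn.
  apply/rowP => j; rewrite !mxE /b; case: ltnP => jn; first exact: cx.
  by apply: gx; rewrite ltn_subLR.
rewrite BE; split.
  move=> [[Gp tx] _]; split; last exact: Gx.1.
  move=> k kn; rewrite -taylorE//.
  by have /rowP/(_ (Ordinal kn)) := tx; rewrite !mxE.
move=> [cx gx]; have Gp := Gx.2 gx; split=> //; split=> //.
by apply/rowP => j; rewrite !mxE taylorE// cx.
Qed.

Theorem theorem5p6 (R : realType) (M : surface R) (m : nat)
    (P : set 'rV[R]_m)
    (X : chart M -> M -> 'rV[R]_m -> 'rV[R]_2) (h : M -> 'rV[R]_m -> R)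
    (n nu : nat) (z0 : M) (p0 : 'rV[R]_m) :
  open P ->
  smooth_vector_field_family P X ->
  smooth_function_family P h ->
  (2 <= n)%N -> (2 <= nu)%N -> ~~ odd nu ->
  transverse_contact P X h nu z0 p0 ->
  exists2 O0 : set (M * 'rV[R]_m), open_nbhs (z0, p0) O0 &
  forall O : set (M * 'rV[R]_m), open_nbhs (z0, p0) O -> O `<=` O0 ->
  let G := projected_stratum P X h nu O in
  forall S : R -> 'rV[R]_m -> R,
    smooth_near_in [set a : R * 'rV[R]_m | G a.2] (0, p0)
      (fun a => S a.1 a.2) ->
    taylor_map n S p0 = 0 ->
    taylor_coef S n p0 != 0 ->
    differential_rank G (taylor_map n S) p0 n ->
    embedded_submanifold_germ (n + nu - 2) P (neutral_grazing_locus n G S) p0 /\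
    (n + nu - 2 <= m)%N.
Proof.
move=> oP sX sh _ nu2 _ contact0.
have [N0 [Q [g [oN0 [oQ QP] sg sur_g GE]]]] :=
  stratum_equations oP sX sh nu2 contact0.
exists N0 => // N oN NN0 G S sS _ _ rkS.
rewrite -addnBA//.
exact: neutral_locus_submanifold oQ QP sg sur_g (GE N oN NN0) sS rkS.
Qed.
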